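(* Let $0<T<\infty$, $a,b\in\mathbb{R}$, and let $(B_t)_{t\in[0,T]}$ be the continuous version of $B_t=\langle\cdot,\mathbf{1}_{[0,t)}\rangle$ on the white noise space, and $$X_t:=a\Big(1-\frac tT\Big)+b\frac tT+B_t-\frac tT B_T,\qquad 0\le t\le T,$$ the one-dimensional Brownian bridge from $a$ to $b$. For $\varepsilon>0$ let $$\mathcal{I}^{BB}_\varepsilon:=\int_0^T\int_0^t p_\varepsilon(X_t-X_s)\,ds\,dt,\qquad p_\varepsilon(x)=\frac{1}{\sqrt{2\pi\varepsilon}}e^{-x^2/(2\varepsilon)}.$$ Then $\mathcal{I}^{BB}_\varepsilon$ converges in $L^2(\mu)$ as $\varepsilon\downarrow 0$; the limit is denoted $\mathcal{I}^{BB}\in L^2(\mu)$.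
   Context: $\mu$ is the white noise measure on the space $\mathcal{S}'(\mathbb{R})$ of tempered distributions, i.e. $\int\exp(i\langle\omega,\xi\rangle)d\mu(\omega)=\exp(-\frac12\langle\xi,\xi\rangle)$ for Schwartz functions $\xi$, where $\langle\cdot,\cdot\rangle$ is the dual pairing extending the $L^2(\mathbb{R})$ inner product; for $\xi\in L^2(\mathbb{R})$, $\langle\cdot,\xi\rangle$ is defined as an $L^2(\mu)$-limit. Then $(B_t)$ is a standard one-dimensional Brownian motion starting at $0$ (continuous modification taken). $L^2(\mu)$ is the space of complex-valued square-integrable functions w.r.t. $\mu$. *)

(* Defs.v *)
From HB Require Import structures.
From mathcomp Require Import all_boot all_order all_algebra.
From mathcomp Require Import all_classical all_reals all_analysis.
Set Implicit Arguments. Unset Strict Implicit. Unset Printing Implicit Defensive.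
Import Order.TTheory GRing.Theory Num.Theory.
Import numFieldNormedType.Exports.
Local Open Scope classical_set_scope.
Local Open Scope ring_scope.

Definition heat_kernel (R : realType) (eps x : R) : R :=
  (Num.sqrt (2 * pi * eps))^-1 * expR (- (x ^+ 2) / (2 * eps)).

Definition lincomb (R : realType) (Om : Type) (B : R -> Om -> R)
  (ct : seq (R * R)) (w : Om) : R :=
  \sum_(p <- ct) p.1 * B p.2 w.

(* Covariance sum_{i,j} c_i c_j min(t_i,t_j) = <xi,xi> for
   xi = sum_i c_i 1_[0,t_i). *)
Definition lincomb_var (R : realType) (ct : seq (R * R)) : R :=
  \sum_(p <- ct) \sum_(q <- ct) p.1 * q.1 * Num.min p.2 q.2.

(* (B_t)_{t >= 0} is a standard one-dimensional Brownian motion started at 0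
   with all paths continuous on [0, +oo): each B_t is measurable, every path
   is continuous, and the finite-dimensional characteristic functional is
   E[exp(i sum_i c_i B_{t_i})] = exp(-1/2 sum_{i,j} c_i c_j min(t_i,t_j)),
   written with its real and imaginary parts.  This is exactly the
   characteristic functional of white noise evaluated at
   xi = sum_i c_i 1_[0,t_i). *)
Definition brownian_motion (R : realType) d (Om : measurableType d)
  (P : probability Om R) (B : R -> Om -> R) : Prop :=
  [/\ (forall t, 0 <= t -> measurable_fun setT (B t)),
      (forall w, {within [set t : R | 0 <= t], continuous (fun t => B t w)}),
      (forall ct : seq (R * R), all (fun p => 0 <= p.2) ct ->
         (\int[P]_w (cos (lincomb B ct w))%:E = (expR (- (lincomb_var ct) / 2))%:E)%E)
    & (forall ct : seq (R * R), all (fun p => 0 <= p.2) ct ->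
         (\int[P]_w (sin (lincomb B ct w))%:E = 0)%E)].

Definition brownian_bridge (R : realType) (Om : Type) (B : R -> Om -> R)
  (T a b : R) (t : R) (w : Om) : R :=
  a * (1 - t / T) + b * (t / T) + B t w - (t / T) * B T w.

Definition self_intersection_eps (R : realType) (Om : Type) (B : R -> Om -> R)
  (T a b eps : R) (w : Om) : R :=
  let X := brownian_bridge B T a b in
  Rintegral lebesgue_measure `[0, T]
    (fun t => Rintegral lebesgue_measure `[0, t]
       (fun s => heat_kernel eps (X t w - X s w))).

(* Main.v *)
(* Fourier inversion of the heat kernel and symmetrization of the time integral
   give I_eps = T^2/(4 pi) * int exp(-eps l^2/2) D(l) dl, where D(l) is the squared
   modulus of the time average of exp(i l X_t). Since D >= 0, I_eps increases as
   eps decreases, and its limit is I = T^2/(4 pi) * int D(l) dl. By dominated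
   convergence the L^2 convergence reduces to E[(int D)^2] < oo, which by AM-GM
   and Tonelli follows from E[D(l)^2] <= C/(1 + l^2)^2. The latter is a fourfold
   time integral of the characteristic function of X_t1 + X_t2 - X_t3 - X_t4,
   whose variance is, for times in one half of [0, T], bounded below by half of
   |t1 - t3| + |t2 - t4| or of |t1 - t4| + |t2 - t3|. *)
Require Import Defs.
From HB Require Import structures.
From mathcomp Require Import all_boot all_order all_algebra.
From mathcomp Require Import all_classical all_reals all_analysis.
From mathcomp Require Import measurable_realfun ring lra.
Set Implicit Arguments. Unset Strict Implicit. Unset Printing Implicit Defensive.
Import Order.TTheory GRing.Theory Num.Theory.
Import numFieldNormedType.Exports.
Local Open Scope classical_set_scope.
Local Open Scope ring_scope.

(** * Integrals against probability measures *)

(** The pinning forces the restriction to halves. For t1 = t2 = T and t3 = t4 = 0 the combination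
    X_t1 + X_t2 - X_t3 - X_t4 is deterministic, so no lower bound of its variance by the distances
    can hold on all of [0, T]. Returning from the halves to the whole interval is cheap, because the
    squared modulus is convex: at the mean of two complex numbers it is at most the mean of its two
    values.

    The Fourier side is chosen because it makes the dependence on eps monotone path by path. The
    candidate limit is then explicit before any estimate, and 0 <= I_eps <= I almost surely supplies
    the dominating function I^2, which replaces a Cauchy estimate for two values of eps. The rate (1
    + l^2)^-2 for a second moment of D is the right target because its square root is integrable
    over the line.

    The endpoints a and b only contribute a deterministic phase, whose cosine is bounded by 1. *)

Lemma measurable_fun_section {d1 d2 d3 : measure_display}
  {T1 : measurableType d1} {T2 : measurableType d2} {T3 : measurableType d3}
  (f : T1 * T2 -> T3) (x : T1) :
  measurable_fun setT f -> measurable_fun setT (fun y => f (x, y)).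
Proof. by move=> mf; apply: measurableT_comp mf _; exact: measurable_fun_pair. Qed.

Section integration.
Context {d1 d2 : measure_display} {T1 : measurableType d1}
  {T2 : measurableType d2} {R : realType}.

(** The positive and negative parts have measurable partial integrals by Tonelli, and [fine] is
    measurable; sections with an infinite integral are thereby covered. *)
Lemma measurable_fun_Rintegral2 (m : {sigma_finite_measure set T2 -> \bar R})
  (f : T1 * T2 -> R) : measurable_fun setT f ->
  measurable_fun setT (fun x => \int[m]_y f (x, y)).
Proof.
move=> mf; have mEf : measurable_fun setT (EFin \o f) by exact/measurable_EFinP.
apply: (measurableT_comp (@fine_measurable R setT measurableT)).
have -> : (fun x => \int[m]_y (f (x, y))%:E)%E =
  (fubini_F m (EFin \o f)^\+ \- fubini_F m (EFin \o f)^\-)%E.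
  by apply/funext => x; rewrite [LHS]integralE /fubini_F/= !unlock.
apply: emeasurable_funB; apply: measurable_fun_fubini_tonelli_F => //.
- exact: measurable_funepos.
- exact: measurable_funeneg.
Qed.

Lemma bounded_integrable (P : probability T1 R) (f : T1 -> R) (M : R) :
  measurable_fun setT f -> (forall x, `|f x| <= M) ->
  P.-integrable setT (EFin \o f).
Proof.
move=> mf fM; apply: measurable_bounded_integrable => //.
  by apply: le_lt_trans (probability_le1 P measurableT) (ltry _).
exists M; split; first exact: num_real.
by move=> x Mx y _ /=; exact: le_trans (fM y) (ltW Mx).
Qed.

Lemma EFin_Rintegral d (T : measurableType d) (m : {measure set T -> \bar R})
  (D : set T) (f : T -> R) : measurable D -> m.-integrable D (EFin \o f) ->
  (\int[m]_(x in D) f x)%:E = (\int[m]_(x in D) (f x)%:E)%E.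
Proof. by move=> mD intf; rewrite fineK//; exact: integrable_fin_num. Qed.

Lemma Rintegral_prob_bound (P : probability T1 R) (f : T1 -> R) (M : R) :
  measurable_fun setT f -> (forall x, `|f x| <= M) -> `|\int[P]_x f x| <= M.
Proof.
move=> mf fM; have intf := bounded_integrable P mf fM.
apply: le_trans (le_normr_Rintegral measurableT intf) _.
rewrite [leRHS](_ : M = \int[P]_x (cst M x)); last first.
  by rewrite Rintegral_cst// [X in fine X](probability_setT P) mulr1.
apply: le_Rintegral => //; last exact: (@bounded_integrable P (cst M) `|M|).
apply: (@bounded_integrable P (fun x => `|f x|) M) => //.
  exact: measurableT_comp.
by move=> x; rewrite normr_id.
Qed.

Lemma Rintegral_prob_le (P : probability T1 R) (f : T1 -> R) (M : R) :
  P.-integrable setT (EFin \o f) -> (forall x, f x <= M) ->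
  \int[P]_x f x <= M.
Proof.
move=> intf fM.
rewrite [leRHS](_ : M = \int[P]_x (cst M x)); last first.
  by rewrite Rintegral_cst// [X in fine X](probability_setT P) mulr1.
apply: le_Rintegral => //.
exact: (@bounded_integrable P (cst M) `|M|).
Qed.

(** Since [g] depends on [y] only and [P] has mass one, integrability on the product reduces to that
    of [g]. Time averages are swapped with a constant [g], the frequency integral with a Gaussian
    [g]. *)
Lemma dominated_fubini (P : probability T1 R)
  (m : {sigma_finite_measure set T2 -> \bar R}) (f : T1 * T2 -> R) (g : T2 -> R) :
  measurable_fun setT f -> m.-integrable setT (EFin \o g) ->
  (forall x y, `|f (x, y)| <= g y) ->
  \int[P]_x \int[m]_y f (x, y) = \int[m]_y \int[P]_x f (x, y).
Proof.
move=> mf intg fg.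
have mEf : measurable_fun setT (EFin \o f) by exact/measurable_EFinP.
have g0 y : 0 <= g y by apply: le_trans (fg point y).
have intx x : m.-integrable setT (fun y => (f (x, y))%:E).
  apply: le_integrable intg => //=.
    by apply/measurable_EFinP; apply: measurableT_comp mf _.
  by move=> y _; rewrite lee_fin (le_trans (fg x y))// ler_norm.
have inty y : P.-integrable setT (fun x => (f (x, y))%:E).
  apply: (@bounded_integrable P (fun x => f (x, y)) (g y)) => //.
  by apply: measurableT_comp mf _.
transitivity (fine (\int[P]_x \int[m]_y (f (x, y))%:E)%E).
  by congr fine; apply: eq_integral => x _; rewrite EFin_Rintegral//; exact: intx.
transitivity (fine (\int[m]_y \int[P]_x (f (x, y))%:E)%E); last first.
  by congr fine; apply: eq_integral => y _; rewrite EFin_Rintegral//; exact: inty.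
congr fine; apply: (@Fubini _ _ _ _ _ P m (EFin \o f)).
apply/integrable12ltyP => //.
have /integrableP[mg intg'] := intg.
apply: (@le_lt_trans _ _ (\int[P]_x \int[m]_y `|(g y)%:E|)%E).
  apply: ge0_le_integral => //.
  - by move=> x _; apply: integral_ge0.
  - apply: (@measurable_fun_fubini_tonelli_F _ _ _ _ _ m (abse \o (EFin \o f))).
      exact: measurableT_comp.
    by move=> z; exact: abse_ge0.
  - move=> x _; apply: ge0_le_integral => //.
    + by apply: measurableT_comp => //; case/integrableP: (intx x).
    + exact: measurableT_comp.
    + by move=> y _; rewrite /= lee_fin (le_trans (fg x y))// ler_norm.
by rewrite integral_cst// [X in (_ * X)%E](probability_setT P) mule1.
Qed.

End integration.

(** * Fourier transform of the Gaussian *)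

Section gaussian_fourier.
Context {R : realType}.
Implicit Types e x y : R.
Local Notation mu := (@lebesgue_measure R).

(** Here [e] is a precision, not a variance: up to a constant this is the Fourier transform of
    [heat_kernel e]. A negative [e] is used as well, to write the inverse of a Gaussian. *)
Definition gaussian e y : R := expR (- (e * y ^+ 2 / 2)).

Lemma gaussian_ge0 e y : 0 <= gaussian e y.
Proof. exact: expR_ge0. Qed.

Lemma is_derive_sqr y : is_derive y 1 (fun z : R => z ^+ 2) (2 * y).
Proof.
have -> : (fun z : R => z ^+ 2) = id * id by apply/funext => z; rewrite expr2.
apply: is_derive_eq.
by rewrite /GRing.scale/=; ring.
Qed.

Lemma is_derive_gaussian e y :
  is_derive y 1 (gaussian e) (- (e * y) * gaussian e y).
Proof.
rewrite mulrC; apply: (is_derive1_comp (is_derive_expR _)).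
have -> : (fun y => - (e * y ^+ 2 / 2)) = (- e / 2) \*: (fun y : R => y ^+ 2).
  apply/funext => z; rewrite -[RHS]/((- e / 2) * z ^+ 2); by field.
apply: (is_derive_eq (is_deriveZ (- e / 2) (is_derive_sqr y))).
by rewrite /GRing.scale/=; field.
Qed.

Lemma continuous_gaussian e : continuous (gaussian e).
Proof.
move=> y; apply: differentiable_continuous; apply/derivable1_diffP.
by have [] := is_derive_gaussian e y.
Qed.

Lemma measurable_gaussian e : measurable_fun setT (gaussian e).
Proof. apply: continuous_measurable_fun; exact: continuous_gaussian. Qed.

Lemma integral_gaussian e : 0 < e ->
  (\int[mu]_y (gaussian e y)%:E = (Num.sqrt (2 * pi / e))%:E)%E.
Proof.
move=> e0; pose s := (Num.sqrt e)^-1.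
have s0 : s != 0 by rewrite invr_neq0// gt_eqF// sqrtr_gt0.
have s2 : s ^+ 2 = e^-1 by rewrite exprVn sqr_sqrtr// ltW.
have := integral_normal_pdf 0 s.
under eq_integral => y _.
  rewrite normal_pdfE// (_ : normal_fun 0 s y = gaussian e y); last first.
    by rewrite /normal_fun /gaussian s2 subr0; congr expR; field; rewrite gt_eqF.
  rewrite EFinM; over.
rewrite ge0_integralZl//=.
- have p1 : ((normal_peak s)^-1 * normal_peak s)%:E = 1%E.
    by rewrite mulVf// gt_eqF// normal_peak_gt0.
  move=> h; rewrite -[LHS]mul1e -p1 EFinM -muleA h mule1.
  rewrite /normal_peak invrK s2; congr (Num.sqrt _)%:E.
  by rewrite -mulr_natr; field; rewrite gt_eqF.
- apply/measurable_EFinP; exact: measurable_gaussian.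
- by move=> y _; rewrite lee_fin gaussian_ge0.
- by rewrite lee_fin normal_peak_ge0.
Qed.

Lemma integrable_gaussian e : 0 < e -> mu.-integrable setT (EFin \o gaussian e).
Proof.
move=> e0; apply/integrableP; split.
  by apply/measurable_EFinP; exact: measurable_gaussian.
under eq_integral do rewrite /= ger0_norm ?gaussian_ge0//.
by rewrite integral_gaussian// ltry.
Qed.

Lemma norm_mul_gaussian_le e y : 0 < e ->
  `|y| * gaussian e y <= (1 + e^-1) * gaussian (e / 2) y.
Proof.
move=> e0.
have -> : gaussian e y = gaussian (e / 2) y * gaussian (e / 2) y.
  by rewrite /gaussian -expRD; congr expR; field.
rewrite mulrA ler_wpM2r ?gaussian_ge0// -ler_pdivlMr ?expR_gt0//.
rewrite /gaussian -expRN opprK.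
have ei : 0 < e^-1 by rewrite invr_gt0.
apply: (@le_trans _ _ ((1 + e^-1) * (1 + e / 2 * y ^+ 2 / 2))); last first.
  by rewrite ler_wpM2l ?expR_ge1Dx// addr_ge0// ltW.
(* Expanding this square gives |y| <= 1/e + e y^2 / 4: one of the two half Gaussians absorbs the
   factor |y|, through exp z >= 1 + z. *)
have : 0 <= e^-1 * (1 - e * `|y| / 2) ^+ 2 by rewrite mulr_ge0 ?sqr_ge0 ?ltW.
have -> : e^-1 * (1 - e * `|y| / 2) ^+ 2 = e^-1 - `|y| + e * `|y| ^+ 2 / 4.
  by field; rewrite gt_eqF.
rewrite real_normK ?num_real// => h.
have : 0 <= e^-1 * (e / 2 * y ^+ 2 / 2).
  by rewrite mulr_ge0 ?(ltW ei)// divr_ge0// mulr_ge0 ?sqr_ge0// divr_ge0// ltW.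
lra.
Qed.

Lemma integrable_mul_gaussian e (f : R -> R) (C : R) : 0 < e ->
  measurable_fun setT f -> (forall y, `|f y| <= C * (1 + `|y|)) ->
  mu.-integrable setT (fun y => (f y * gaussian e y)%:E).
Proof.
move=> e0 mf fC.
have C0 : 0 <= C by have := le_trans (normr_ge0 _) (fC 0); rewrite normr0 addr0 mulr1.
have e20 : 0 < e / 2 by rewrite divr_gt0.
apply: (@le_integrable _ _ _ mu setT measurableT _
  (fun y => (C%:E * (gaussian e y)%:E
    + (C * (1 + e^-1))%:E * (gaussian (e / 2) y)%:E)%E)) => //.
- apply/measurable_EFinP; apply: measurable_funM => //; exact: measurable_gaussian.
- move=> y _; rewrite -!EFinM -EFinD !abse_EFin lee_fin normrM.
  rewrite (ger0_norm (gaussian_ge0 _ _)).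
  apply: le_trans (ler_norm _).
  apply: (le_trans (ler_wpM2r (gaussian_ge0 e y) (fC y))).
  rewrite mulrDr mulr1 mulrDl lerD2l -!mulrA ler_wpM2l//.
  exact: norm_mul_gaussian_le.
- by apply: integrableD => //; apply: integrableZl => //; exact: integrable_gaussian.
Qed.

End gaussian_fourier.

Section gaussian_fourier_transform.
Context {R : realType}.
Implicit Types e x y : R.
Local Notation mu := (@lebesgue_measure R).

Lemma is_derive_sinM x y : is_derive y 1 (fun z => sin (x * z)) (x * cos (x * y)).
Proof.
rewrite mulrC; apply: (is_derive1_comp (is_derive_sin _)).
apply: (is_derive_eq (is_deriveZ x (is_derive_id y 1))); exact: mulr1.
Qed.

Lemma is_derive_cosM y x :
  is_derive x 1 (fun z => cos (z * y)) (- sin (x * y) * y).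
Proof.
apply: (is_derive1_comp (is_derive_cos _)).
have -> : (fun z => z * y) = y \*: (@id R).
  by apply/funext => z; rewrite mulrC.
apply: (is_derive_eq (is_deriveZ y (is_derive_id x 1))); exact: mulr1.
Qed.

Lemma continuous_cosM x : continuous (fun y => cos (x * y)).
Proof.
move=> y; apply: continuous_comp; last exact: continuous_cos.
by apply: cvgM; [exact: cvg_cst|exact: cvg_id].
Qed.

Lemma continuous_sinM x : continuous (fun y => sin (x * y)).
Proof.
move=> y; apply: continuous_comp; last exact: continuous_sin.
by apply: cvgM; [exact: cvg_cst|exact: cvg_id].
Qed.

Lemma measurable_cos_comp {d : measure_display} {S : measurableType d}
  (f : S -> R) : measurable_fun setT f -> measurable_fun setT (fun t => cos (f t)).
Proof.
apply: (measurableT_comp (f := cos)).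
by apply: continuous_measurable_fun; exact: continuous_cos.
Qed.

Lemma measurable_sin_comp {d : measure_display} {S : measurableType d}
  (f : S -> R) : measurable_fun setT f -> measurable_fun setT (fun t => sin (f t)).
Proof.
apply: (measurableT_comp (f := sin)).
by apply: continuous_measurable_fun; exact: continuous_sin.
Qed.

Lemma norm_cos_le1 x : `|cos x| <= 1.
Proof. by rewrite ler_norml cos_geN1 cos_le1. Qed.

Lemma norm_sin_le1 x : `|sin x| <= 1.
Proof. by rewrite ler_norml sin_geN1 sin_le1. Qed.

Lemma integrable_cos_gaussian e x : 0 < e ->
  mu.-integrable setT (fun y => (cos (x * y) * gaussian e y)%:E).
Proof.
move=> e0; apply: (@integrable_mul_gaussian _ _ _ 1) => //.
  by apply: continuous_measurable_fun; exact: continuous_cosM.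
by move=> y; rewrite mul1r (le_trans (norm_cos_le1 _))// lerDl.
Qed.

Lemma integrable_mul_sin_gaussian e x : 0 < e ->
  mu.-integrable setT (fun y => (y * sin (x * y) * gaussian e y)%:E).
Proof.
move=> e0; apply: (@integrable_mul_gaussian _ _ _ 1) => //.
  apply: measurable_funM => //.
  by apply: continuous_measurable_fun; exact: continuous_sinM.
move=> y; rewrite mul1r normrM (@le_trans _ _ (`|y| * 1))//.
  by rewrite ler_wpM2l// norm_sin_le1.
by rewrite mulr1 lerDr.
Qed.

(** The integrand is the derivative of sin(x y) times the Gaussian, which vanishes at both
    infinities. This integration by parts is the source of the differential equation for the Fourier
    transform. *)
Lemma integral_sin_gaussian_derivative e x : 0 < e ->
  \int[mu]_y ((x * cos (x * y) - e * (y * sin (x * y))) * gaussian e y) = 0.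
Proof.
move=> e0; pose g y := (x * cos (x * y) - e * (y * sin (x * y))) * gaussian e y.
pose F y := sin (x * y) * gaussian e y.
have dF y : is_derive y 1 F (g y).
  have ? := is_derive_sinM x y; have ? := is_derive_gaussian e y.
  have -> : F = (fun y => sin (x * y)) * gaussian e by [].
  apply: is_derive_eq; rewrite /GRing.scale/= /g; ring.
have cg : continuous g.
  move=> y; apply: cvgM; last exact: continuous_gaussian.
  apply: cvgB; apply: cvgM; try exact: cvg_cst; first exact: continuous_cosM.
  by apply: cvgM; [exact: cvg_id|exact: continuous_sinM].
have intg : mu.-integrable setT (EFin \o g).
  have -> : EFin \o g = (fun y => (x%:E * (cos (x * y) * gaussian e y)%:E -
      e%:E * (y * sin (x * y) * gaussian e y)%:E)%E).
    by apply/funext => y; rewrite /= -!EFinM -EFinB /g; congr EFin; ring.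
  by apply: integrableB => //; apply: integrableZl => //;
    [exact: integrable_cos_gaussian|exact: integrable_mul_sin_gaussian].
have mg : measurable_fun setT (EFin \o g) by case/integrableP: intg.
(* The integrals over [-(n+1), n+1] have two limits to compare: dominated convergence gives the full
   integral, the fundamental theorem of calculus gives boundary terms that tend to 0. *)
pose f_ (n : nat) := (EFin \o g) \_ `[- n.+1%:R, n.+1%:R].
have lim1 : (\int[mu]_y f_ n y)%E @[n --> \oo] --> (\int[mu]_y (g y)%:E)%E.
  have [] // := @dominated_convergence _ _ _ mu setT measurableT f_ (EFin \o g)
    (abse \o (EFin \o g)).
  - by move=> n; apply/measurable_restrict => //; exact: measurable_funTS.
  - apply: aeW => y _; apply: cvg_near_cst; near=> n.
    rewrite /f_ patchE mem_set//= in_itv/= -ler_norml.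
    apply: (@le_trans _ _ n%:R); last by rewrite ler_nat.
    by near: n; exact: nbhs_infty_ger.
  - exact: integrable_abse.
  - apply: aeW => y n _; rewrite /f_ patchE; case: ifPn => _; first exact: lexx.
    by rewrite abse0 abse_ge0.
have lim2 : (\int[mu]_y f_ n y)%E @[n --> \oo] --> 0%E.
  have -> : (fun n => \int[mu]_y f_ n y)%E =
      (fun n => (F n.+1%:R - F (- n.+1%:R))%:E).
    apply/funext => n; rewrite /f_ -integral_mkcond EFinB.
    apply: continuous_FTC2.
    - by rewrite gtrN.
    - exact: continuous_subspaceT.
    - have cF : continuous F.
        move=> y; apply: differentiable_continuous; apply/derivable1_diffP.
        by have [] := dF y.
      split; first by move=> y _; have [] := dF y.
      + exact: cvg_at_right_filter (cF _).
      + exact: cvg_at_left_filter (cF _).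
    - by move=> y _; rewrite derive1E; have [_] := dF y.
  apply: cvg_EFin; first by apply: nearW.
  apply/norm_cvg0P; apply: (@squeeze_cvgr _ _ _ _ (cst 0)
    (fun n => 2 * (1 + e^-1) * harmonic n)); last first.
  - by rewrite -[X in _ --> X](mulr0 (2 * (1 + e^-1))); apply: cvgM;
      [exact: cvg_cst|exact: cvg_harmonic].
  - exact: cvg_cst.
  apply: nearW => n; rewrite normr_ge0/=.
  (* At |y| = n + 1 the bound on |y| times the Gaussian turns into a decay of order 1/(n+1) for the
     boundary terms. *)
  have FF y : `|y| = n.+1%:R -> `|F y| <= (1 + e^-1) * harmonic n.
    move=> yn; rewrite /harmonic/= ler_pdivlMr// -yn mulrC.
    rewrite normrM (ger0_norm (gaussian_ge0 _ _)) mulrCA.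
    apply: (@le_trans _ _ (1 * ((1 + e^-1) * gaussian (e / 2) y))).
      apply: ler_pM; rewrite ?mulr_ge0 ?gaussian_ge0 ?norm_sin_le1//.
      exact: norm_mul_gaussian_le.
    rewrite mul1r ler_piMr// ?addr_ge0 ?invr_ge0 ?(ltW e0)//.
    by rewrite -expR0 ler_expR oppr_le0 divr_ge0// mulr_ge0 ?sqr_ge0// divr_ge0// ltW.
  apply: le_trans (ler_normB _ _) _.
  by rewrite -mulrA mulr_natl mulr2n lerD// FF// ?normrN ger0_norm.
apply/eqP; rewrite /Rintegral.
by rewrite (cvg_unique _ lim1 lim2).
Unshelve. all: end_near.
Qed.

Let G e x := \int[mu]_y (cos (x * y) * gaussian e y).

(** Differentiation under the integral, dominated by |y| times the Gaussian whatever the value of x,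
    produces the integral of y sin(x y) times the Gaussian; the previous lemma expresses it through
    [G] itself. *)
Let is_derive_G e x : 0 < e -> is_derive x 1 (G e) (- (x / e) * G e x).
Proof.
move=> e0; pose f (x y : R) := cos (x * y) * gaussian e y.
have df x' y : is_derive x' 1 (f ^~ y) (- (y * sin (x' * y) * gaussian e y)).
  have ? := is_derive_cosM y x'.
  have -> : f ^~ y = gaussian e y \*: (fun z : R => cos (z * y)).
    by apply/funext => z; rewrite /f mulrC.
  by apply: is_derive_eq; rewrite /GRing.scale/=; ring.
have pf x' y : partial1of2 f x' y = - (y * sin (x' * y) * gaussian e y).
  by rewrite partial1of2E; apply: derive_val.
have xI : `]x - 1, x + 1[%classic x by rewrite /= in_itv/=; lra.
have intf x' : `]x - 1, x + 1[%classic x' -> mu.-integrable setT (EFin \o f x').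
  by move=> _; exact: integrable_cos_gaussian.
have derf (x' y : R) : `]x - 1, x + 1[%classic x' -> [set: R] y ->
  derivable (f ^~ y) x' 1 by move=> _ _; have [] := df x' y.
have K0 (y : R) : 0 <= `|y| * gaussian e y by rewrite mulr_ge0// gaussian_ge0.
have intK : mu.-integrable setT (EFin \o (fun y : R => `|y| * gaussian e y)).
  apply: (@integrable_mul_gaussian _ _ _ 1) => //.
  by move=> y; rewrite mul1r normr_id lerDr.
have fK (x' y : R) : `]x - 1, x + 1[%classic x' -> [set: R] y ->
    `|partial1of2 f x' y| <= `|y| * gaussian e y.
  move=> _ _; rewrite pf normrN !normrM (ger0_norm (gaussian_ge0 _ _)).
  by rewrite ler_wpM2r ?gaussian_ge0// ler_piMr// norm_sin_le1.
have dG := derivable_under_integral measurableT xI intf derf K0 intK fK.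
have vG := differentiation_under_integral measurableT xI intf derf K0 intK fK.
apply: DeriveDef; first exact: dG.
rewrite -derive1E [LHS]vG.
under eq_Rintegral do rewrite pf.
have h := integral_sin_gaussian_derivative x e0.
have ic := integrable_cos_gaussian x e0.
have is_ := integrable_mul_sin_gaussian x e0.
rewrite [X in X = 0](_ : _ = \int[mu]_y (x * (cos (x * y) * gaussian e y) -
    e * (y * sin (x * y) * gaussian e y))) in h; last first.
  by apply: eq_Rintegral => y _; ring.
rewrite RintegralB// in h; first last.
- exact: (integrableZl _ _ is_).
- exact: (integrableZl _ _ ic).
rewrite !RintegralZl// in h.
under eq_Rintegral do rewrite -mulN1r.
rewrite RintegralZl//.
move/eqP: h; rewrite subr_eq0 => /eqP h.
have -> : \int[mu]_y (y * sin (x * y) * gaussian e y) = e^-1 * (x * G e x).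
  by rewrite h mulrA mulVf ?mul1r// gt_eqF.
by field; rewrite gt_eqF.
Qed.

Lemma Rintegral_cos_gaussian e x : 0 < e ->
  \int[mu]_y (cos (x * y) * gaussian e y) =
  Num.sqrt (2 * pi / e) * expR (- (x ^+ 2 / (2 * e))).
Proof.
move=> e0; have ei0 : 0 < e^-1 by rewrite invr_gt0.
(* The second factor is exp(x^2 / (2 e)), the inverse of the expected Gaussian, so the differential
   equation says that [H] is constant, equal to [G e 0]. *)
pose H x := G e x * gaussian (- e^-1) x.
have dH x' : is_derive x' 1 H 0.
  have ? := is_derive_G x' e0; have ? := is_derive_gaussian (- e^-1) x'.
  have -> : H = G e * gaussian (- e^-1) by [].
  by apply: is_derive_eq; rewrite /GRing.scale/=; ring.
have := is_derive_0_is_cst x 0 dH.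
rewrite /H {2}/gaussian expr0n/= mulr0 mul0r oppr0 expR0 mulr1.
have -> : G e 0 = Num.sqrt (2 * pi / e).
  rewrite /G; under eq_Rintegral do rewrite mul0r cos0 mul1r.
  by rewrite /Rintegral integral_gaussian.
move=> <-; rewrite -mulrA -expRD.
rewrite [X in expR X](_ : _ = 0) ?expR0 ?mulr1//.
by field; rewrite gt_eqF.
Qed.

Lemma heat_kernelE e x : 0 < e ->
  heat_kernel e x = (2 * pi)^-1 * \int[mu]_y (cos (x * y) * gaussian e y).
Proof.
move=> e0; rewrite Rintegral_cos_gaussian// /heat_kernel mulrA mulNr.
congr (_ * _); move: (2 * pi) (mulr_gt0 (ltr0Sn R 1) (pi_gt0 R)) => a a0.
rewrite !sqrtrM ?(ltW a0)// sqrtrV ?ltW//.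
have aE : a^-1 = (Num.sqrt a ^+ 2)^-1 by rewrite sqr_sqrtr// ltW.
rewrite [X in _ = X * _]aE.
by field; rewrite !gt_eqF ?sqrtr_gt0.
Qed.

End gaussian_fourier_transform.

(** * Joint measurability of continuous processes *)

Section continuous_paths.
Context {R : realType} {d : measure_display} {Om : measurableType d}.

Lemma within_continuous_seq (A : set R) (f : R -> R) (u : nat -> R) (x : R) :
  {within A, continuous f} -> A x -> (forall n, A (u n)) ->
  u n @[n --> \oo] --> x -> f (u n) @[n --> \oo] --> f x.
Proof.
move=> /subspace_continuousP/(_ x) cf Ax Au ux; have {}cf := cf Ax.
apply: cvg_trans cf => S /= fS; rewrite /nbhs/=.
have h : \forall n \near \oo, A (u n) -> S (f (u n)) := ux _ fS.
by apply: filterS h => n; apply; exact: Au.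
Qed.

(** The uniform probability lives on the whole line while [B] is constrained at nonnegative times
    only; composing with this retraction onto [u, v] yields total functions that are measurable and
    bounded everywhere. *)
Definition clamp (u v t : R) : R := Num.max u (Num.min t v).

Lemma clamp_itv (u v t : R) : u <= v -> u <= clamp u v t <= v.
Proof.
by move=> uv; rewrite /clamp le_max lexx/= ge_max uv ge_min lexx orbT.
Qed.

Lemma clamp_id (u v t : R) : u <= t <= v -> clamp u v t = t.
Proof. by move=> /andP[ut tv]; rewrite /clamp min_l// max_r. Qed.

Lemma measurable_clamp (u v : R) : measurable_fun setT (clamp u v).
Proof. by apply: measurable_maxr => //; exact: measurable_minr. Qed.

Lemma cvg_truncn_div (x : R) : 0 <= x ->
  (Num.trunc (x * n.+1%:R))%:R / n.+1%:R @[n --> \oo] --> x.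
Proof.
move=> x0; apply: (@squeeze_cvgr _ _ _ _ (fun n => x - harmonic n) (cst x)).
- apply: nearW => n; have n0 : 0 < n.+1%:R :> R by [].
  have /truncn_itv/andP[h1 h2] : 0 <= x * n.+1%:R by rewrite mulr_ge0.
  rewrite ler_pdivrMr// h1 andbT /= lerBlDr /harmonic/=.
  rewrite -[X in _ + X]mul1r -mulrDl ler_pdivlMr//.
  by rewrite natr1 ltW.
- by rewrite -[X in _ --> X]subr0; apply: cvgB; [exact: cvg_cst|exact: cvg_harmonic].
- exact: cvg_cst.
Qed.

(** By path continuity the process is the pointwise limit of its values at grid times rounded down
    to multiples of 1/(n+1). Rounded times stay nonnegative, hence inside the domain of
    continuity. *)
Lemma measurable_fun_continuous_paths (B : R -> Om -> R) (T : R) : 0 <= T ->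
  (forall t, 0 <= t -> measurable_fun setT (B t)) ->
  (forall w, {within [set t : R | 0 <= t], continuous (fun t => B t w)}) ->
  measurable_fun setT (fun z : Om * R => B (clamp 0 T z.2) z.1).
Proof.
move=> T0 mB cB.
pose q n t : R := (Num.trunc (clamp 0 T t * n.+1%:R))%:R / n.+1%:R.
have q0 n t : 0 <= q n t by rewrite divr_ge0.
have c0 t : 0 <= clamp 0 T t by case/andP: (clamp_itv t T0).
apply: (@measurable_fun_cvg _ _ _ _ (fun n z => B (q n z.2) z.1)); last first.
  move=> [w t] _ /=.
  apply: (within_continuous_seq (cB w)) => //=.
  exact: cvg_truncn_div.
move=> n _ Y mY; rewrite setTI.
(* The discretised process is constant in time on each grid cell, so a preimage is a countable union
   of measurable rectangles indexed by the cell. *)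
rewrite [X in measurable X](_ : _ = \bigcup_k
    ((B (k%:R / n.+1%:R) @^-1` Y) `*`
     ((fun t => clamp 0 T t * n.+1%:R) @^-1` `[k%:R, k.+1%:R[))); last first.
  apply/seteqP; split => [[w t]/= BY|[w t]/= [k _ [/= BY]]].
    exists (Num.trunc (clamp 0 T t * n.+1%:R)) => //=; split => //=.
    by rewrite in_itv/=; apply: truncn_itv; rewrite mulr_ge0.
  by rewrite in_itv/= => /truncn_def tk; rewrite /q tk.
apply: bigcupT_measurable => k; apply: measurableX.
  by rewrite -[X in measurable X]setTI; apply: mB => //; rewrite divr_ge0.
rewrite -[X in measurable X]setTI.
have : measurable_fun setT (fun t => clamp 0 T t * n.+1%:R).
  by apply: measurable_funM => //; exact: measurable_clamp.
by apply.
Qed.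

End continuous_paths.

(** * Fourth moment of the empirical characteristic function of the bridge *)

Section pair_energy.
Context {R : realType}.
Implicit Types t : R.

(* The variance of [B t1 + B t2 - B t3 - B t4]. *)
Definition pair_energy t1 t2 t3 t4 : R :=
  `|t1 - t3| + `|t1 - t4| + `|t2 - t3| + `|t2 - t4| - `|t1 - t2| - `|t3 - t4|.

(* [x], [y], [z] are the gaps between the four sorted times; the two pairs
   interlace or are nested here, and are separated in the next lemma. *)
Let sqr_le_crossed (L x y z D V : R) : 0 <= x -> 0 <= y -> 0 <= z ->
  x + y + z <= L -> `|D| <= x + z -> V = x + z -> D ^+ 2 <= L * V.
Proof.
move=> x0 y0 z0 xyzL Dxz ->.
rewrite -real_normK ?num_real// expr2 ler_pM//; lra.
Qed.

Let sqr_le_separated (L x y z D V : R) : 0 <= x -> 0 <= y -> 0 <= z ->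
  x + y + z <= L -> `|D| <= x + 2 * y + z -> V = x + 4 * y + z ->
  D ^+ 2 <= L * V.
Proof.
move=> x0 y0 z0 xyzL Dxz ->.
apply: (@le_trans _ _ ((x + 2 * y + z) ^+ 2)).
  by rewrite -real_normK ?num_real// lerXn2r ?nnegrE//; lra.
(* The difference of the two sides is x y + y z. Equality at x = z = 0, two coincident pairs, is the
   configuration in which a bridge pinned at both ends degenerates. *)
apply: (@le_trans _ _ ((x + y + z) * (x + 4 * y + z))); last first.
  by rewrite ler_wpM2r//; lra.
have := mulr_ge0 x0 y0; have := mulr_ge0 z0 y0; lra.
Qed.

(** Let xi = 1_[0,t1) + 1_[0,t2) - 1_[0,t3) - 1_[0,t4), which lives on [u, v]. The energy is the
    integral of xi^2 and t1 + t2 - t3 - t4 is the integral of xi, so the second bound is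
    Cauchy-Schwarz. As xi is integer valued, xi^2 >= |xi|, and the integral of |xi| is the cheaper
    of the two matchings, whence the first bound. The proof checks both by cases on the order of the
    times. *)
Lemma pair_energy_bounds (u v t1 t2 t3 t4 : R) :
  u <= t1 <= v -> u <= t2 <= v -> u <= t3 <= v -> u <= t4 <= v ->
  (`|t1 - t3| + `|t2 - t4| <= pair_energy t1 t2 t3 t4 \/
   `|t1 - t4| + `|t2 - t3| <= pair_energy t1 t2 t3 t4) /\
  (t1 + t2 - t3 - t4) ^+ 2 <= (v - u) * pair_energy t1 t2 t3 t4.
Proof.
wlog t12 : t1 t2 / t1 <= t2.
  move=> h; have [t12|/ltW t21] := leP t1 t2; first exact: h.
  move=> h1 h2 h3 h4; have [] := h t2 t1 t21 h2 h1 h3 h4.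
  have -> : pair_energy t2 t1 t3 t4 = pair_energy t1 t2 t3 t4.
    by rewrite /pair_energy (distrC t2 t1); ring.
  rewrite (addrC t2 t1) => -[] h5 h6; split => //; [right|left]; lra.
wlog t34 : t3 t4 / t3 <= t4.
  move=> h; have [t34|/ltW t43] := leP t3 t4; first exact: h.
  move=> h1 h2 h3 h4; have [] := h t4 t3 t43 h1 h2 h4 h3.
  have -> : pair_energy t1 t2 t4 t3 = pair_energy t1 t2 t3 t4.
    by rewrite /pair_energy (distrC t4 t3); ring.
  have -> : t1 + t2 - t4 - t3 = t1 + t2 - t3 - t4 by ring.
  by move=> -[] h5 h6; split => //; [right|left].
move=> /andP[h1 h1'] /andP[h2 h2'] /andP[h3 h3'] /andP[h4 h4'].
rewrite /pair_energy (ler0_norm (_ : t1 - t2 <= 0)) ?subr_le0//.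
rewrite (ler0_norm (_ : t3 - t4 <= 0)) ?subr_le0//.
case: (ger0P (t1 - t3)) => a13; case: (ger0P (t1 - t4)) => a14;
case: (ger0P (t2 - t3)) => a23; case: (ger0P (t2 - t4)) => a24; try lra.
all: split; [try (by left; lra); try (by right; lra)|].
(* One alternative for each interleaving of t1 <= t2 with t3 <= t4: two separated ones, then the
   four crossed or nested ones. *)
all: first
  [ apply: (@sqr_le_separated _ (t4 - t3) (t1 - t4) (t2 - t1)); try lra; rewrite ler_norml; apply/andP; split; lra
  | apply: (@sqr_le_separated _ (t2 - t1) (t3 - t2) (t4 - t3)); try lra; rewrite ler_norml; apply/andP; split; lra
  | apply: (@sqr_le_crossed _ (t1 - t3) (t4 - t1) (t2 - t4)); try lra; rewrite ler_norml; apply/andP; split; lra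
  | apply: (@sqr_le_crossed _ (t1 - t3) (t2 - t1) (t4 - t2)); try lra; rewrite ler_norml; apply/andP; split; lra
  | apply: (@sqr_le_crossed _ (t3 - t1) (t4 - t3) (t2 - t4)); try lra; rewrite ler_norml; apply/andP; split; lra
  | apply: (@sqr_le_crossed _ (t3 - t1) (t2 - t3) (t4 - t2)); try lra; rewrite ler_norml; apply/andP; split; lra].
Qed.

(** The last entry of the list collects the terms -(t/T) B_T of the four bridge values. The
    covariance min(s,t) - s t / T of the bridge explains the subtracted square. *)
Lemma lincomb_var_bridge (T l t1 t2 t3 t4 : R) : 0 < T ->
  t1 <= T -> t2 <= T -> t3 <= T -> t4 <= T ->
  lincomb_var [:: (l, t1); (l, t2); (- l, t3); (- l, t4);
    (- l * ((t1 + t2 - t3 - t4) / T), T)] =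
  l ^+ 2 * (pair_energy t1 t2 t3 t4 - (t1 + t2 - t3 - t4) ^+ 2 / T).
Proof.
move=> T0 h1 h2 h3 h4; rewrite /lincomb_var !big_cons !big_nil /=.
rewrite !(minC T) !(min_l h1, min_l h2, min_l h3, min_l h4, minxx).
rewrite !minr_absE /pair_energy (distrC t2 t1) (distrC t3 t1) (distrC t4 t1)
  (distrC t3 t2) (distrC t4 t2) (distrC t4 t3).
by field; rewrite gt_eqF.
Qed.

End pair_energy.

(** Used with c = l^2 / 4, half of the exponent l^2 / 2 in the characteristic function of a Brownian
    increment; the other half is given up to the pinning. *)
Definition exp_dist {R : realType} (c s t : R) : R := expR (- (c * `|s - t|)).

(** * Four-time characteristic function of the bridge *)

Section bridge_characteristic_function.
Context {R : realType} {d : measure_display} {Om : measurableType d}.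
Variables (P : probability Om R) (B : R -> Om -> R) (T a b : R).
Hypotheses (bmB : brownian_motion P B) (T0 : 0 < T).
Implicit Types (t l : R).

Let X := brownian_bridge B T a b.

Lemma measurable_lincomb (ct : seq (R * R)) :
  (forall t, 0 <= t -> measurable_fun setT (B t)) ->
  all (fun p => 0 <= p.2) ct -> measurable_fun setT (lincomb B ct).
Proof.
move=> mB; elim: ct => [|p ct ih].
  move=> _; rewrite (_ : lincomb B [::] = cst 0)//.
  by apply/funext => w; rewrite /lincomb big_nil.
move=> /= /andP[p0 {}/ih ih].
rewrite (_ : lincomb B _ = (fun w => p.1 * B p.2 w + lincomb B ct w)); last first.
  by apply/funext => w; rewrite /lincomb big_cons.
by apply: measurable_funD => //; apply: measurable_funM => //; exact: mB.
Qed.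

Lemma expectation_cos_lincomb (m : R) (ct : seq (R * R)) :
  all (fun p => 0 <= p.2) ct ->
  \int[P]_w cos (m + lincomb B ct w) = cos m * expR (- (lincomb_var ct) / 2).
Proof.
have [mB _ cB sB] := bmB => ct0; have mL := measurable_lincomb mB ct0.
have icos := bounded_integrable P (measurable_cos_comp mL) (fun w => norm_cos_le1 _).
have isin := bounded_integrable P (measurable_sin_comp mL) (fun w => norm_sin_le1 _).
under eq_Rintegral do rewrite cosD.
rewrite RintegralB//.
- rewrite !RintegralZl//.
  by rewrite /Rintegral cB// sB//= mulr0 subr0.
- exact: (integrableZl _ _ icos).
- exact: (integrableZl _ _ isin).
Qed.

(* Pinning at [T] subtracts [(t1 + t2 - t3 - t4)^2 / T] from the variance, which
   is at most half of it because the four times lie in an interval of length at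
   most [T / 2]. *)
Lemma expectation_cos_bridge_le (u v l t1 t2 t3 t4 : R) :
  0 <= u -> v <= T -> v - u <= T / 2 ->
  u <= t1 <= v -> u <= t2 <= v -> u <= t3 <= v -> u <= t4 <= v ->
  \int[P]_w cos (l * (X t1 w + X t2 w - X t3 w - X t4 w)) <=
  expR (- (l ^+ 2 / 4 * `|t1 - t3|)) * expR (- (l ^+ 2 / 4 * `|t2 - t4|)) +
  expR (- (l ^+ 2 / 4 * `|t1 - t4|)) * expR (- (l ^+ 2 / 4 * `|t2 - t3|)).
Proof.
move=> u0 vT uvT h1 h2 h3 h4.
have [min_le sq_le] := pair_energy_bounds h1 h2 h3 h4.
move: (h1) (h2) (h3) (h4) => /andP[p1 q1] /andP[p2 q2] /andP[p3 q3] /andP[p4 q4].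
set ct := [:: (l, t1); (l, t2); (- l, t3); (- l, t4);
  (- l * ((t1 + t2 - t3 - t4) / T), T)].
have ct0 : all (fun p => 0 <= p.2) ct.
  by rewrite /= (le_trans u0 p1) (le_trans u0 p2) (le_trans u0 p3) (le_trans u0 p4) ltW.
pose m := l * (a * (1 - t1 / T) + b * (t1 / T) + (a * (1 - t2 / T) + b * (t2 / T))
  - (a * (1 - t3 / T) + b * (t3 / T)) - (a * (1 - t4 / T) + b * (t4 / T))).
have -> : \int[P]_w cos (l * (X t1 w + X t2 w - X t3 w - X t4 w)) =
    \int[P]_w cos (m + lincomb B ct w).
  apply: eq_Rintegral => w _; congr cos.
  rewrite /lincomb !big_cons big_nil /= /X /brownian_bridge /m.
  by field; rewrite gt_eqF.
rewrite expectation_cos_lincomb//.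
(* Bounding cos m by 1 removes all dependence on the endpoints [a] and [b]. *)
apply: (@le_trans _ _ (expR (- lincomb_var ct / 2))).
  by rewrite ler_piMl ?expR_ge0// cos_le1.
rewrite lincomb_var_bridge//; try exact: le_trans vT.
set V := pair_energy _ _ _ _ in min_le sq_le *.
have V0 : 0 <= V.
  by case: min_le => /(le_trans _); apply; rewrite addr_ge0.
have VT : (t1 + t2 - t3 - t4) ^+ 2 / T <= V / 2.
  rewrite ler_pdivrMr// (le_trans sq_le)// mulrAC -mulrA mulrC.
  by rewrite ler_wpM2l// mulrC.
have {sq_le}VV : expR (- (l ^+ 2 * (V - (t1 + t2 - t3 - t4) ^+ 2 / T)) / 2) <=
    expR (- (l ^+ 2 / 4 * V)).
  rewrite ler_expR mulNr lerN2.
  rewrite (_ : l ^+ 2 / 4 * V = l ^+ 2 * (V / 4)); last by ring.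
  rewrite -[leRHS]mulrA ler_wpM2l ?sqr_ge0//.
  rewrite [leRHS](_ : _ = (V - V / 2 + (V / 2 - (t1 + t2 - t3 - t4) ^+ 2 / T)) / 2).
    by rewrite -subr_ge0 in VT; lra.
  by ring.
apply: (le_trans VV); rewrite -!expRD -!opprD -!mulrDr.
case: min_le => hV; [rewrite -[leLHS]addr0|rewrite -[leLHS]add0r];
  by rewrite lerD ?expR_ge0// ler_expR lerN2 ler_wpM2l// divr_ge0// sqr_ge0.
Qed.

(** Product-to-sum yields half the sum of two four-time expectations. The pairing (t1 t2)(t3 t4)
    comes from both, each of the other two pairings from one, so the sum over all three pairings,
    symmetric in the times, is an upper bound. *)
Lemma expectation_cos_cos_bridge_le (u v l t1 t2 t3 t4 : R) :
  0 <= u -> v <= T -> v - u <= T / 2 ->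
  u <= t1 <= v -> u <= t2 <= v -> u <= t3 <= v -> u <= t4 <= v ->
  \int[P]_w (cos (l * (X t1 w - X t2 w)) * cos (l * (X t3 w - X t4 w))) <=
  exp_dist (l ^+ 2 / 4) t1 t2 * exp_dist (l ^+ 2 / 4) t3 t4 +
  exp_dist (l ^+ 2 / 4) t1 t3 * exp_dist (l ^+ 2 / 4) t2 t4 +
  exp_dist (l ^+ 2 / 4) t1 t4 * exp_dist (l ^+ 2 / 4) t2 t3.
Proof.
move=> u0 vT uvT h1 h2 h3 h4; rewrite /exp_dist.
have := expectation_cos_bridge_le l u0 vT uvT h1 h3 h2 h4.
have := expectation_cos_bridge_le l u0 vT uvT h1 h4 h2 h3.
have [mB _ _ _] := bmB.
have mX t : u <= t <= v -> measurable_fun setT (X t).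
  move=> /andP[ut _]; apply: measurable_funB.
    by apply: measurable_funD => //; apply: mB; exact: le_trans ut.
  by apply: measurable_funM => //; apply: mB; exact: ltW.
have icos t t' s s' (ht : u <= t <= v) (ht' : u <= t' <= v) (hs : u <= s <= v)
    (hs' : u <= s' <= v) :
    P.-integrable setT (EFin \o (fun w => cos (l * (X t w + X t' w - X s w - X s' w)))).
  apply: (@bounded_integrable _ _ _ P _ 1); last first.
    by move=> w; exact: norm_cos_le1.
  apply: measurable_cos_comp.
  apply: measurable_funM => //; apply: (measurable_funB _ (mX _ hs')).
  by apply: (measurable_funB _ (mX _ hs)); exact: (measurable_funD (mX _ ht) (mX _ ht')).
move=> h14 h13.
rewrite [leLHS](_ : _ = 2^-1 *
  (\int[P]_w cos (l * (X t1 w + X t4 w - X t2 w - X t3 w)) +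
   \int[P]_w cos (l * (X t1 w + X t3 w - X t2 w - X t4 w)))); last first.
  rewrite -RintegralD//; [|exact: icos|exact: icos].
  rewrite -RintegralZl//; last exact: (integrableD _ (icos _ _ _ _ h1 h4 h2 h3) (icos _ _ _ _ h1 h3 h2 h4)).
  apply: eq_Rintegral => w _.
  rewrite (_ : l * (X t1 w + X t4 w - X t2 w - X t3 w) =
    l * (X t1 w - X t2 w) - l * (X t3 w - X t4 w)); last by ring.
  rewrite (_ : l * (X t1 w + X t3 w - X t2 w - X t4 w) =
    l * (X t1 w - X t2 w) + l * (X t3 w - X t4 w)); last by ring.
  by rewrite cosB cosD; field.
have e0 (x : R) : 0 <= expR x by exact: expR_ge0.
move: h14 h13; rewrite !(distrC t4 t2) !(distrC t4 t3) !(distrC t3 t2).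
set E1 := \int[P]_w _; set E2 := \int[P]_w _ => h14 h13.
have m1 := mulr_ge0 (e0 (- (l ^+ 2 / 4 * `|t1 - t3|))) (e0 (- (l ^+ 2 / 4 * `|t2 - t4|))).
have m2 := mulr_ge0 (e0 (- (l ^+ 2 / 4 * `|t1 - t4|))) (e0 (- (l ^+ 2 / 4 * `|t2 - t3|))).
lra.
Qed.

End bridge_characteristic_function.

(** * Second moment of the squared modulus of a random characteristic function *)

Section fourth_moment.
Context {d d' : measure_display} {Om : measurableType d} {S : measurableType d'}
  {R : realType}.
Variables (P : probability Om R) (U : probability S R).

(** One application integrates out one time variable of the fourfold average. *)
Lemma expectation_average_le (f : Om * S -> R) (g : S -> R) (M N : R) :
  measurable_fun setT f -> (forall z, `|f z| <= M) ->
  measurable_fun setT g -> (forall t, `|g t| <= N) ->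
  (forall t, \int[P]_w f (w, t) <= g t) ->
  \int[P]_w \int[U]_t f (w, t) <= \int[U]_t g t.
Proof.
move=> mf fM mg gN fg.
rewrite (@dominated_fubini _ _ _ _ _ P U f (cst M))//; last first.
  exact: (@bounded_integrable _ _ _ U (cst M) `|M|).
apply: le_Rintegral => //; last exact: bounded_integrable gN.
apply: (@bounded_integrable _ _ _ U _ M).
  apply: (@measurable_fun_Rintegral2 _ _ _ _ _ P (fun z : S * Om => f (z.2, z.1))).
  by apply: measurableT_comp mf _; exact: measurable_fun_pair.
move=> t; apply: Rintegral_prob_bound => //.
by apply: measurableT_comp mf _; exact: measurable_fun_pair.
Qed.

(** The squared modulus of the integral of exp(i Z) against [U], in real and imaginary parts. *)
Definition mod2_charfun (Z : S -> R) : R :=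
  (\int[U]_t cos (Z t)) ^+ 2 + (\int[U]_t sin (Z t)) ^+ 2.

Lemma mod2_charfun_ge0 Z : 0 <= mod2_charfun Z.
Proof. by rewrite addr_ge0 ?sqr_ge0. Qed.

Lemma mod2_charfunE (Z : S -> R) : measurable_fun setT Z ->
  mod2_charfun Z = \int[U]_t \int[U]_s cos (Z t - Z s).
Proof.
move=> mZ.
have ic := bounded_integrable U (measurable_cos_comp mZ) (fun w => norm_cos_le1 _).
have is_ := bounded_integrable U (measurable_sin_comp mZ) (fun w => norm_sin_le1 _).
have inner t : \int[U]_s cos (Z t - Z s) =
    cos (Z t) * \int[U]_s cos (Z s) + sin (Z t) * \int[U]_s sin (Z s).
  under eq_Rintegral do rewrite cosB.
  rewrite RintegralD ?RintegralZl//;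
    [exact: (integrableZl _ _ ic)|exact: (integrableZl _ _ is_)].
under eq_Rintegral do rewrite inner.
rewrite RintegralD//; [|exact: (integrableZr _ _ ic)|exact: (integrableZr _ _ is_)].
by rewrite !RintegralZr// -!expr2.
Qed.

Lemma mod2_charfun_le2 (Z : S -> R) : measurable_fun setT Z ->
  mod2_charfun Z <= 2.
Proof.
move=> mZ; rewrite /mod2_charfun.
have := Rintegral_prob_bound U (measurable_cos_comp mZ) (fun w => norm_cos_le1 _).
have := Rintegral_prob_bound U (measurable_sin_comp mZ) (fun w => norm_sin_le1 _).
move: (\int[U]_t sin _) (\int[U]_t cos _) => x y.
rewrite !ler_norml => /andP[x1 x2] /andP[y1 y2].
have sqr1 z : -1 <= z -> z <= 1 -> z ^+ 2 <= 1 :> R.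
  by move=> z1 z2; rewrite -real_normK ?num_real// expr_le1// ler_norml z1 z2.
by rewrite [leRHS](_ : _ = 1 + 1) ?lerD ?sqr1.
Qed.

Lemma measurable_mod2_charfun (Z : Om * S -> R) : measurable_fun setT Z ->
  measurable_fun setT (fun w => mod2_charfun (fun t => Z (w, t))).
Proof.
move=> mZ; apply: measurable_funD; apply: measurable_funX.
  exact: measurable_fun_Rintegral2 (measurable_cos_comp mZ).
exact: measurable_fun_Rintegral2 (measurable_sin_comp mZ).
Qed.

(** The square of the modulus is the fourfold time average of the products of cosines bounded in the
    last hypothesis. In each of the three pairings the two factors share no time, so each averages
    to at most k^2. *)
Lemma expectation_mod2_charfun_sqr_le (Z : Om * S -> R) (e : S -> S -> R) (k : R) :
  measurable_fun setT Z ->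
  (forall s, measurable_fun setT (e s)) ->
  (forall s t, 0 <= e s t <= 1) -> (forall s t, e s t = e t s) ->
  (forall s, \int[U]_t e s t <= k) ->
  (forall t1 t2 t3 t4,
    \int[P]_w (cos (Z (w, t1) - Z (w, t2)) * cos (Z (w, t3) - Z (w, t4))) <=
      e t1 t2 * e t3 t4 + e t1 t3 * e t2 t4 + e t1 t4 * e t2 t3) ->
  \int[P]_w (mod2_charfun (fun t => Z (w, t)) ^+ 2) <= 3 * k ^+ 2.
Proof.
move=> mZ me e01 eC ek Ke.
pose c z := cos (Z z); pose s z := sin (Z z).
pose C w := \int[U]_t c (w, t); pose D w := mod2_charfun (fun t => Z (w, t)).
pose V w := \int[U]_t s (w, t).
have mc : measurable_fun setT c := measurable_cos_comp mZ.
have ms : measurable_fun setT s := measurable_sin_comp mZ.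
have mC : measurable_fun setT C := measurable_fun_Rintegral2 _ mc.
have mV : measurable_fun setT V := measurable_fun_Rintegral2 _ ms.
have mD : measurable_fun setT D := measurable_mod2_charfun mZ.
have mcw w : measurable_fun setT (fun t => c (w, t)).
  by apply: measurableT_comp mc _; exact: measurable_fun_pair.
have msw w : measurable_fun setT (fun t => s (w, t)).
  by apply: measurableT_comp ms _; exact: measurable_fun_pair.
have mct t : measurable_fun setT (fun z : Om * S => c (z.1, t)).
  by apply: measurableT_comp mc _; exact: measurable_fun_pair.
have mst t : measurable_fun setT (fun z : Om * S => s (z.1, t)).
  by apply: measurableT_comp ms _; exact: measurable_fun_pair.
have m1 (f : Om -> R) : measurable_fun setT f ->
    measurable_fun setT (fun z : Om * S => f z.1).
  by move=> mf; apply: measurableT_comp mf _; exact: measurable_fst.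
have c1 z : `|c z| <= 1 := norm_cos_le1 _.
have s1 z : `|s z| <= 1 := norm_sin_le1 _.
have C1 w : `|C w| <= 1 by exact: Rintegral_prob_bound.
have V1 w : `|V w| <= 1 by exact: Rintegral_prob_bound.
have D2 w : `|D w| <= 2.
  rewrite ger0_norm ?mod2_charfun_ge0// mod2_charfun_le2//.
  by apply: measurableT_comp mZ _; exact: measurable_fun_pair.
(* The integrands are linear in the cosine and sine at one time, so averaging that time replaces
   them by [C w] and [V w]; two averages of this kind rebuild [D w]. *)
have avg w (x y z : R) :
    \int[U]_t ((x * c (w, t) + y * s (w, t)) * z) = (x * C w + y * V w) * z.
  have ic := bounded_integrable U (mcw w) (fun t => c1 (w, t)).
  have is_ := bounded_integrable U (msw w) (fun t => s1 (w, t)).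
  have icx := integrableZl measurableT x ic.
  have isy := integrableZl measurableT y is_.
  rewrite RintegralZr//; last exact: (integrableD _ icx isy).
  by rewrite RintegralD// !RintegralZl.
have dot_le (x y x' y' : R) : `|x| <= 1 -> `|y| <= 1 -> `|x'| <= 1 -> `|y'| <= 1 ->
    `|x * x' + y * y'| <= 2.
  move=> hx hy hx' hy'; apply: le_trans (ler_normD _ _) _; rewrite !normrM.
  rewrite [leRHS](_ : _ = 1 * 1 + 1 * 1); last by ring.
  by rewrite lerD// ler_pM.
have prod_le (x y : R) : `|x| <= 2 -> `|y| <= 2 -> `|x * y| <= 4.
  by move=> hx hy; rewrite normrM [leRHS](_ : _ = 2 * 2) ?ler_pM//; ring.
have k0 : 0 <= k.
  by apply: le_trans (ek point); apply: Rintegral_ge0 => t _; case/andP: (e01 point t).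
have norme x t : `|e x t| <= 1 by have /andP[? ?] := e01 x t; rewrite ger0_norm.
have ie x := bounded_integrable U (me x) (norme x).
have ecst (x : R) : \int[U]_t x = x.
  by rewrite Rintegral_cst// [X in fine X](probability_setT U) mulr1.
have icst (x : R) : U.-integrable setT (EFin \o cst x).
  exact: (@bounded_integrable _ _ _ U (cst x) `|x|).
have lin_le p q r (x y z : R) : 0 <= x <= 1 -> 0 <= y <= 1 -> 0 <= z <= 1 ->
  \int[U]_t (x * e p t + y * e q t + z * e r t) <= k * (x + y + z).
  move=> /andP[x0 x1] /andP[y0 y1] /andP[z0 z1].
  have ix := integrableZl measurableT x (ie p).
  have iy := integrableZl measurableT y (ie q).
  have iz := integrableZl measurableT z (ie r).
  rewrite RintegralD//; last exact: (integrableD _ ix iy).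
  rewrite RintegralD// !RintegralZl// !mulrDr !(mulrC k).
  by rewrite !lerD// ler_wpM2l.
have norm_lin p q r (x y z : R) t : 0 <= x <= 1 -> 0 <= y <= 1 -> 0 <= z <= 1 ->
  `|x * e p t + y * e q t + z * e r t| <= 3.
  move=> /andP[x0 x1] /andP[y0 y1] /andP[z0 z1].
  have /andP[p0 p1] := e01 p t; have /andP[q0 q1] := e01 q t.
  have /andP[r0 r1] := e01 r t.
  rewrite ger0_norm ?addr_ge0 ?mulr_ge0// [leRHS](_ : _ = 1 * 1 + 1 * 1 + 1 * 1).
    by rewrite !lerD// ler_pM.
  by ring.
have m_lin p q r (x y z : R) :
  measurable_fun setT (fun t => x * e p t + y * e q t + z * e r t).
  by apply: measurable_funD; [apply: measurable_funD|]; apply: measurable_funM.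
have eqle (x y : R) : x = y -> x <= y by move=> ->.
have i01 : 0 <= (1 : R) <= 1 by rewrite ler01 lexx.
(* The square of [D] is a fourfold average over times; [E3], [E2], [E1] and the
   final step bound its expectation after averaging out the fourth, third,
   second and first time respectively. *)
have E3 t1 t2 t3 : \int[P]_w ((c (w, t1) * c (w, t2) + s (w, t1) * s (w, t2)) *
    (c (w, t3) * C w + s (w, t3) * V w)) <= k * (e t1 t2 + e t1 t3 + e t2 t3).
  pose f (z : Om * S) := (c (z.1, t3) * c z + s (z.1, t3) * s z) *
    (c (z.1, t1) * c (z.1, t2) + s (z.1, t1) * s (z.1, t2)).
  apply: le_trans (lin_le t3 t2 t1 _ _ _ (e01 t1 t2) (e01 t1 t3) (e01 t2 t3)).
  rewrite (_ : \int[P]_w _ = \int[P]_w \int[U]_t f (w, t)); last first.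
    by apply: eq_Rintegral => w _; rewrite /f/= avg mulrC.
  apply: (@expectation_average_le f _ 4 3) => //.
  - by apply: measurable_funM; apply: measurable_funD; apply: measurable_funM.
  - by move=> z; apply: prod_le; exact: dot_le.
  - by move=> t; exact: norm_lin.
  - move=> t4; rewrite (mulrC (e t2 t3)); apply: le_trans (Ke t1 t2 t3 t4).
    by apply: eqle; apply: eq_Rintegral => w _; rewrite /f !cosB mulrC.
have E2 t1 t2 : \int[P]_w ((c (w, t1) * c (w, t2) + s (w, t1) * s (w, t2)) * D w)
    <= k * (e t1 t2 + k + k).
  pose f (z : Om * S) := (C z.1 * c z + V z.1 * s z) *
    (c (z.1, t1) * c (z.1, t2) + s (z.1, t1) * s (z.1, t2)).
  rewrite (_ : \int[P]_w _ = \int[P]_w \int[U]_t f (w, t)); last first.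
    by apply: eq_Rintegral => w _; rewrite /f/= avg mulrC /D /mod2_charfun !expr2.
  (* The term with coefficient 0 is padding: it gives the integrand the three-term shape of [lin_le]
     and [norm_lin]. *)
  apply: (@le_trans _ _ (\int[U]_t (k * (e t1 t2 + (0 * e t1 t + 1 * e t1 t + 1 * e t2 t))))).
    apply: (@expectation_average_le f _ 4 (k * 4)) => //.
    - by apply: measurable_funM; apply: measurable_funD; apply: measurable_funM => //;
        exact: m1.
    - by move=> z; apply: prod_le; exact: dot_le.
    - by apply: measurable_funM => //; apply: measurable_funD.
    - move=> t; rewrite normrM ger0_norm// ler_wpM2l//.
      apply: le_trans (ler_normD _ _) _; rewrite [leRHS](_ : _ = 1 + 3); last by ring.
      by rewrite lerD// norm_lin// lexx ler01.
    - move=> t3; rewrite mul0r add0r !mul1r addrA; apply: le_trans (E3 t1 t2 t3).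
      by apply: eqle; apply: eq_Rintegral => w _; rewrite /f/= mulrC (mulrC (C w)) (mulrC (V w)).
  have il : U.-integrable setT
      (EFin \o (fun t => 0 * e t1 t + 1 * e t1 t + 1 * e t2 t)).
    by apply: bounded_integrable (m_lin _ _ _ _ _ _) _ => t; apply: norm_lin;
      rewrite ?lexx ?ler01.
  rewrite RintegralZl//; last exact: (integrableD _ (icst _) il).
  rewrite ler_wpM2l// RintegralD//; last exact: icst.
  rewrite ecst -addrA lerD2l.
  apply: (le_trans (lin_le t1 t1 t2 0 1 1 _ i01 i01)); first by rewrite lexx ler01.
  by rewrite add0r mulrDr mulr1.
have E1 t1 : \int[P]_w ((c (w, t1) * C w + s (w, t1) * V w) * D w) <= 3 * k ^+ 2.
  pose f (z : Om * S) := (c (z.1, t1) * c z + s (z.1, t1) * s z) * D z.1.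
  rewrite (_ : \int[P]_w _ = \int[P]_w \int[U]_t f (w, t)); last first.
    by apply: eq_Rintegral => w _; rewrite /f/= avg.
  apply: (@le_trans _ _ (\int[U]_t (k * (e t1 t + (k + k))))).
    apply: (@expectation_average_le f _ 4 (k * (1 + (k + k)))) => //.
    - apply: measurable_funM; last exact: m1.
      by apply: measurable_funD; apply: measurable_funM.
    - by move=> z; apply: prod_le => //; exact: dot_le.
    - by apply: measurable_funM => //; exact: measurable_funD.
    - move=> t; rewrite normrM ger0_norm// ler_wpM2l//.
      apply: le_trans (ler_normD _ _) _; rewrite lerD//.
      by rewrite ger0_norm// addr_ge0.
    - by move=> t; rewrite addrA; exact: E2.
  rewrite RintegralZl//; last exact: (integrableD _ (ie _) (icst _)).
  rewrite RintegralD//; last exact: icst.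
  rewrite ecst expr2 mulrCA ler_wpM2l//.
  by have := ek t1; lra.
pose f (z : Om * S) := (C z.1 * c z + V z.1 * s z) * D z.1.
rewrite (_ : \int[P]_w _ = \int[P]_w \int[U]_t f (w, t)); last first.
  by apply: eq_Rintegral => w _; rewrite /f/= avg -!expr2.
rewrite -(ecst (3 * k ^+ 2)).
apply: (@expectation_average_le f _ 4 `|3 * k ^+ 2|) => //.
- apply: measurable_funM; last exact: m1.
  by apply: measurable_funD; apply: measurable_funM => //; exact: m1.
- by move=> z; apply: prod_le => //; exact: dot_le.
- move=> t; apply: le_trans (E1 t).
  by apply: eqle; apply: eq_Rintegral => w _; rewrite /f/= (mulrC (C w)) (mulrC (V w)).
Qed.

End fourth_moment.

(** * Time integrals of the exponential kernel *)

Section exp_dist.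
Context {R : realType}.
Local Notation mu := (@lebesgue_measure R).

Lemma expRN_le (y : R) : 0 <= y -> expR (- y) <= 2 * (1 + y ^+ 2)^-1.
Proof.
move=> y0; rewrite expRN -div1r ler_pdivrMr ?expR_gt0// mulrAC.
rewrite ler_pdivlMr ?mul1r; last by have := sqr_ge0 y; lra.
have := expR_ge1Dxn 1 y0; rewrite /= (_ : 2`!%:R = 2)//.
by have := sqr_ge0 y; lra.
Qed.

Lemma exp_dist01 (c s t : R) : 0 <= c -> 0 <= exp_dist c s t <= 1.
Proof.
move=> c0; rewrite expR_ge0/= -expR0 ler_expR oppr_le0 mulr_ge0//.
Qed.

Lemma measurable_exp_dist (c s : R) : measurable_fun setT (exp_dist c s).
Proof.
apply: measurableT_comp => //; apply: measurableT_comp => //.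
apply: measurable_funM => //; apply: measurableT_comp => //.
exact: measurable_funB.
Qed.

(** The kernel is compared with 2 / (1 + c^2 (t - s)^2), which has no kink at t = s and whose
    antiderivative (2/c) atan(c (t - s)) varies by at most 2 pi / c. The bound is therefore uniform
    in [s] and in the interval. *)
Lemma integral_exp_dist_le (c u v s : R) : 0 < c -> u < v ->
  (\int[mu]_(t in `[u, v]) (exp_dist c s t)%:E <= (2 * pi / c)%:E)%E.
Proof.
move=> c0 uv.
pose f t : R := 2 * (1 + (c * (t - s)) ^+ 2)^-1.
pose F t : R := 2 / c * atan (c * (t - s)).
have dF (t : R) : is_derive t 1 F (f t).
  have d1 : is_derive t 1 (fun t => c * (t - s)) c.
    have -> : (fun t => c * (t - s)) = c \*: (@id R - cst s) by [].
    by apply: is_derive_eq; rewrite subr0; exact: mulr1.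
  have d2 := @is_derive1_comp R atan (fun t => c * (t - s)) t _ _
    (is_derive1_atan (c * (t - s))) d1.
  apply: (is_derive_eq (is_deriveZ (2 / c) d2)).
  rewrite /GRing.scale/= /f; field; apply/andP.
  by rewrite !gt_eqF//; have := sqr_ge0 (c * (t - s)); lra.
have cf : continuous f.
  move=> t; apply: cvgM; first exact: cvg_cst.
  apply: cvgV; first by rewrite gt_eqF//; have := sqr_ge0 (c * (t - s)); lra.
  apply: cvgD; first exact: cvg_cst.
  have h : c * (z - s) @[z --> t] --> c * (t - s).
    by apply: cvgM; [exact: cvg_cst|apply: cvgB; [exact: cvg_id|exact: cvg_cst]].
  by rewrite expr2; under eq_fun do rewrite expr2; exact: cvgM.
apply: (@le_trans _ _ (\int[mu]_(t in `[u, v]) (f t)%:E)%E).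
  apply: ge0_le_integral => //=.
  - by move=> t _; rewrite lee_fin expR_ge0.
  - apply/measurable_EFinP; apply: measurable_funTS.
    exact: measurable_exp_dist.
  - apply/measurable_EFinP; apply: measurable_funTS.
    exact: continuous_measurable_fun.
  - move=> t _; rewrite lee_fin /exp_dist distrC.
    have -> : f t = 2 * (1 + (c * `|t - s|) ^+ 2)^-1.
      by rewrite /f exprMn [in RHS]exprMn real_normK ?num_real.
    by apply: expRN_le; rewrite mulr_ge0// ltW.
have cF : continuous F.
  move=> y; apply: differentiable_continuous; apply/derivable1_diffP.
  by have [] := dF y.
rewrite (@continuous_FTC2 _ _ F)//.
- rewrite -EFinB lee_fin /F -mulrBr.
  have := atan_ltpi2 (c * (v - s)); have := atan_gtNpi2 (c * (u - s)) => h1 h2.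
  rewrite -mulrA [pi / c]mulrC mulrA ler_wpM2l ?divr_ge0 ?(ltW c0)//; lra.
- exact: continuous_subspaceT.
- split; first by move=> y _; have [] := dF y.
  + exact: cvg_at_right_filter (cF _).
  + exact: cvg_at_left_filter (cF _).
- by move=> y _; rewrite derive1E; have [_] := dF y.
Qed.

Lemma Rintegral_uniform_clamped_exp_dist_le (c u v s : R) (uv : u < v)
  (cl : R -> R) : 0 < c ->
  measurable_fun setT cl -> (forall t, u <= t <= v -> cl t = t) ->
  \int[uniform_prob uv]_t exp_dist c s (cl t) <= 2 * pi / (c * (v - u)).
Proof.
move=> c0 mcl clE.
rewrite /Rintegral integral_uniform; last 2 first.
  apply/measurable_EFinP; apply: measurableT_comp mcl.
  exact: measurable_exp_dist.
  by move=> t; rewrite lee_fin expR_ge0.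
rewrite [X in fine (_ * X)](_ : _ = \int[mu]_(t in `[u, v]) (exp_dist c s t)%:E)%E; last first.
  by apply: eq_integral => t; rewrite inE/= in_itv/= => /clE ->.
have h := integral_exp_dist_le s c0 uv.
have v0 : 0 < (v - u)^-1 by rewrite invr_gt0 subr_gt0.
have fin : (\int[mu]_(t in `[u, v]) (exp_dist c s t)%:E)%E \is a fin_num.
  rewrite ge0_fin_numE ?(le_lt_trans h) ?ltry//.
  by apply: integral_ge0 => t _; rewrite lee_fin expR_ge0.
rewrite fineM//= invfM mulrA mulrC ler_wpM2r ?(ltW v0)//.
by rewrite -lee_fin fineK.
Qed.

End exp_dist.

(** * Averages over an interval *)

Section uniform_average.
Context {R : realType}.
Local Notation mu := (@lebesgue_measure R).

Lemma bounded_integrable_itv (u v M : R) (f : R -> R) :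
  measurable_fun setT f -> (forall t, `|f t| <= M) ->
  mu.-integrable `[u, v] (EFin \o f).
Proof.
move=> mf fM; apply: measurable_bounded_integrable => //.
- by rewrite /= lebesgue_measure_itv; case: ifP => // _; rewrite -EFinB ltry.
- exact: measurable_funTS.
exists M; split; first exact: num_real.
by move=> x Mx y _ /=; exact: le_trans (fM y) (ltW Mx).
Qed.

Lemma Rintegral_uniform (u v M : R) (uv : u < v) (f : R -> R) :
  measurable_fun setT f -> (forall t, `|f t| <= M) ->
  \int[uniform_prob uv]_t f t = (v - u)^-1 * \int[mu]_(t in `[u, v]) f t.
Proof.
move=> mf fM.
have vu0 : v - u != 0 by rewrite subr_eq0 gt_eqF.
have iU := bounded_integrable (uniform_prob uv) mf fM.
have iL := bounded_integrable_itv u v mf fM.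
have icU : (uniform_prob uv).-integrable setT (EFin \o cst M).
  exact: (@bounded_integrable _ _ _ (uniform_prob uv) (cst M) `|M|).
have icL : mu.-integrable `[u, v] (EFin \o cst M).
  exact: (@bounded_integrable_itv u v `|M| (cst M)).
(* [integral_uniform] is applied to the nonnegative function f + M; the contribution of the constant
   cancels at the end. *)
have h : \int[uniform_prob uv]_t (f t + M) =
    (v - u)^-1 * \int[mu]_(t in `[u, v]) (f t + M).
  rewrite /Rintegral integral_uniform.
  - rewrite fineM//; apply: integrable_fin_num => //.
    exact: (integrableD _ iL icL).
  - by apply/measurable_EFinP; exact: measurable_funD.
  - move=> t; rewrite lee_fin.
    by have := fM t; rewrite ler_norml => /andP[h _]; lra.
have muE : fine (mu `[u, v]) = v - u.
  by rewrite /= lebesgue_measure_itv/= lte_fin uv.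
rewrite RintegralD// in h; rewrite RintegralD// in h.
rewrite Rintegral_cst// [X in M * fine X](probability_setT (uniform_prob uv)) mulr1 in h.
rewrite Rintegral_cst// muE mulrDr (mulrC M) mulKf// in h.
exact: addIr h.
Qed.

Lemma eq_Rintegral_uniform (u v M : R) (uv : u < v) (f g : R -> R) :
  measurable_fun setT f -> (forall t, `|f t| <= M) ->
  measurable_fun setT g -> (forall t, `|g t| <= M) ->
  (forall t, u <= t <= v -> f t = g t) ->
  \int[uniform_prob uv]_t f t = \int[uniform_prob uv]_t g t.
Proof.
move=> mf fM mg gM fg.
rewrite (Rintegral_uniform _ mf fM) (Rintegral_uniform _ mg gM); congr (_ * _).
by apply: eq_Rintegral => t; rewrite inE/= in_itv/=; exact: fg.
Qed.

Lemma Rintegral_uniform_halves (T M : R) (T0 : 0 < T) (h0 : 0 < T / 2)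
  (hT : T / 2 < T) (f : R -> R) :
  measurable_fun setT f -> (forall t, `|f t| <= M) ->
  \int[uniform_prob T0]_t f t =
  (\int[uniform_prob h0]_t f t + \int[uniform_prob hT]_t f t) / 2.
Proof.
move=> mf fM; rewrite !(Rintegral_uniform _ mf fM).
have := @Rintegral_itvB _ f (BLeft 0) (BRight T) (T / 2)
  (bounded_integrable_itv 0 T mf fM).
rewrite !bnd_simp => /(_ (ltW h0) (ltW hT)).
rewrite Rintegral_itv_obnd_cbnd; last first.
  apply: integrableS (bounded_integrable_itv 0 T mf fM) => //.
  by apply: subset_itvr; rewrite bnd_simp ltW.
move=> <-; rewrite !subr0 (_ : T - T / 2 = T / 2); last by field.
by field; rewrite gt_eqF.
Qed.

End uniform_average.

Lemma half_sqr_le {R : realFieldType} (x y : R) :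
  ((x + y) / 2) ^+ 2 <= 2^-1 * (x ^+ 2 + y ^+ 2).
Proof. by have := sqr_ge0 (x - y); lra. Qed.

(** Convexity of the squared modulus, with x for real and y for imaginary parts: it bounds the
    modulus over [0, T] by those over the two halves. *)
Lemma sqr_half_le {R : realFieldType} (x1 x2 y1 y2 : R) :
  ((x1 + x2) / 2) ^+ 2 + ((y1 + y2) / 2) ^+ 2 <=
  (x1 ^+ 2 + y1 ^+ 2 + (x2 ^+ 2 + y2 ^+ 2)) / 2.
Proof. by have := half_sqr_le x1 x2; have := half_sqr_le y1 y2; lra. Qed.

Lemma half_add_le {R : realFieldType} (x y z : R) :
  x <= z -> y <= z -> 2^-1 * (x + y) <= z.
Proof. by move=> xz yz; lra. Qed.

(** * Decay in the frequency for the bridge *)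

Section bridge_fourth_moment.
Context {R : realType} {d : measure_display} {Om : measurableType d}.
Variables (P : probability Om R) (B : R -> Om -> R) (T a b : R).
Hypotheses (bmB : brownian_motion P B) (T0 : 0 < T).

Let X := brownian_bridge B T a b.

Lemma measurable_bridge :
  measurable_fun setT (fun z : Om * R => X (clamp 0 T z.2) z.1).
Proof.
have [mB cB _ _] := bmB.
have mc : measurable_fun setT (fun z : Om * R => clamp 0 T z.2 / T).
  apply: measurable_funM => //.
  by apply: (measurableT_comp (measurable_clamp 0 T)); exact: measurable_snd.
have mBT : measurable_fun setT (fun z : Om * R => B T z.1).
  by apply: (measurableT_comp (mB _ (ltW T0))); exact: measurable_fst.
have mBc := measurable_fun_continuous_paths (ltW T0) mB cB.
apply: measurable_funB; last exact: measurable_funM.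
apply: measurable_funD => //; apply: measurable_funD; apply: measurable_funM => //.
exact: measurable_funB.
Qed.

Lemma measurable_bridge_path w : measurable_fun setT (fun t => X (clamp 0 T t) w).
Proof. exact: (measurable_fun_section w measurable_bridge). Qed.

Lemma expectation_mod2_charfun_bridge_itv (u v l : R) (uv : u < v) :
  0 <= u -> v <= T -> v - u <= T / 2 -> l != 0 ->
  \int[P]_w (mod2_charfun (uniform_prob uv)
    (fun t => l * X (clamp 0 T t) w) ^+ 2) <=
  3 * (2 * pi / (l ^+ 2 / 4 * (v - u))) ^+ 2.
Proof.
move=> u0 vT uvT l0.
have c0 : 0 < l ^+ 2 / 4 by rewrite divr_gt0// exprn_even_gt0.
(* The correlation bound is required at every quadruple of real times, so times are clamped to
   [u, v] here. On [u, v], which carries the uniform probability, this agrees with clamping to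
   [0, T]. *)
pose Z (z : Om * R) := l * X (clamp u v z.2) z.1.
have cluv t := clamp_itv t (ltW uv).
have cl0T t : clamp 0 T (clamp u v t) = clamp u v t.
  apply: clamp_id; have /andP[h1 h2] := cluv t.
  by rewrite (le_trans u0 h1) (le_trans h2 vT).
have mZ : measurable_fun setT Z.
  apply: measurable_funM => //.
  have -> : (fun z : Om * R => X (clamp u v z.2) z.1) =
      (fun z => X (clamp 0 T z.2) z.1) \o (fun z => (z.1, clamp u v z.2)).
    apply/funext => -[w t].
    by rewrite -[RHS]/(X (clamp 0 T (clamp u v t)) w) cl0T.
  apply: (measurableT_comp measurable_bridge); apply: measurable_fun_pair => //.
  by apply: (measurableT_comp (measurable_clamp u v)); exact: measurable_snd.
have -> : \int[P]_w (mod2_charfun (uniform_prob uv)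
      (fun t => l * X (clamp 0 T t) w) ^+ 2) =
    \int[P]_w (mod2_charfun (uniform_prob uv) (fun t => Z (w, t)) ^+ 2).
  apply: eq_Rintegral => w _; congr (_ ^+ 2).
  have m1 : measurable_fun setT (fun t => l * X (clamp 0 T t) w).
    by apply: measurable_funM => //; exact: measurable_bridge_path.
  have m2 : measurable_fun setT (fun t => Z (w, t)).
    exact: (measurable_fun_section w mZ).
  have eqZ t : u <= t <= v -> l * X (clamp 0 T t) w = Z (w, t).
    by move=> tuv; rewrite -[RHS]/(l * X (clamp u v t) w) -(cl0T t) (clamp_id tuv).
  congr (_ ^+ 2 + _ ^+ 2).
  - apply: (@eq_Rintegral_uniform _ u v 1) => //; try exact: measurable_cos_comp.
    + by move=> t; exact: norm_cos_le1.
    + by move=> t; exact: norm_cos_le1.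
    + by move=> t /eqZ ->.
  - apply: (@eq_Rintegral_uniform _ u v 1) => //; try exact: measurable_sin_comp.
    + by move=> t; exact: norm_sin_le1.
    + by move=> t; exact: norm_sin_le1.
    + by move=> t /eqZ ->.
apply: (@expectation_mod2_charfun_sqr_le _ _ _ _ _ P (uniform_prob uv) Z
  (fun s t => exp_dist (l ^+ 2 / 4) (clamp u v s) (clamp u v t))) => //.
- move=> s; apply: measurableT_comp (measurable_clamp u v).
  exact: measurable_exp_dist.
- by move=> s t; apply: exp_dist01; exact: ltW.
- by move=> s t; rewrite /exp_dist distrC.
- move=> s; apply: Rintegral_uniform_clamped_exp_dist_le => //.
    exact: measurable_clamp.
  exact: clamp_id.
- move=> t1 t2 t3 t4; rewrite /Z.
  under eq_Rintegral do rewrite /= -!mulrBr.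
  exact: (expectation_cos_cos_bridge_le _ _ bmB T0 l u0 vT uvT).
Qed.

(** Two bounds are merged: the trivial one, D^2 <= 4, for low frequencies and the decay l^-4 for
    high ones. *)
Lemma expectation_mod2_charfun_bridge_le : exists C : R, forall l : R,
  \int[P]_w (mod2_charfun (uniform_prob T0)
    (fun t => l * X (clamp 0 T t) w) ^+ 2) <= C / (1 + l ^+ 2) ^+ 2.
Proof.
have h0 : 0 < T / 2 by rewrite divr_gt0.
have hT : T / 2 < T by lra.
(* On a half, of length T / 2 and with c = l^2 / 4, the kernel average is at most k = 16 pi / (T
   l^2), and 3 k^2 = A / l^4. *)
pose A : R := 3 * (16 * pi / T) ^+ 2.
(* From (1 + z)^2 <= 2 + 2 z^2 with z = l^2: twice the trivial bound 4 plus twice [A]. *)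
exists (8 + 2 * A).
move=> l; have l1 : 0 < (1 + l ^+ 2) ^+ 2.
  by rewrite exprn_gt0//; have := sqr_ge0 l; lra.
rewrite ler_pdivlMr//.
pose Z w t := l * X (clamp 0 T t) w.
have mZw w : measurable_fun setT (Z w).
  by apply: measurable_funM => //; exact: measurable_bridge_path.
have mZ : measurable_fun setT (fun z : Om * R => Z z.1 z.2).
  by apply: measurable_funM => //; exact: measurable_bridge.
pose D w := mod2_charfun (uniform_prob T0) (Z w).
pose D1 w := mod2_charfun (uniform_prob h0) (Z w).
pose D2 w := mod2_charfun (uniform_prob hT) (Z w).
have Dle u v (uv : u < v) w : mod2_charfun (uniform_prob uv) (Z w) ^+ 2 <= 4.
  have h := mod2_charfun_le2 (uniform_prob uv) (mZw w).
  rewrite [leRHS](_ : _ = 2 ^+ 2); last by ring.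
  by rewrite lerXn2r ?nnegrE ?mod2_charfun_ge0.
have iD u v (uv : u < v) :
    P.-integrable setT (EFin \o (fun w => mod2_charfun (uniform_prob uv) (Z w) ^+ 2)).
  apply: (@bounded_integrable _ _ _ P _ 4).
    by apply: measurable_funX; exact: (measurable_mod2_charfun (uniform_prob uv) mZ).
  by move=> w; rewrite ger0_norm ?sqr_ge0.
have E4 : \int[P]_w (D w ^+ 2) <= 4.
  apply: (@Rintegral_prob_le _ _ _ P (fun w => D w ^+ 2) 4 (iD 0 T T0)) => w.
  exact: Dle.
have EA : \int[P]_w (D w ^+ 2) * (l ^+ 2) ^+ 2 <= A.
  have [->|l0] := eqVneq l 0.
    by rewrite expr0n/= expr0n/= mulr0 mulr_ge0// sqr_ge0.
  have l20 : l ^+ 2 != 0 by rewrite sqrf_eq0.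
  have e1 := expectation_mod2_charfun_bridge_itv h0 (lexx 0) (ltW hT).
  have {}e1 := e1 l _ l0; rewrite subr0 in e1; have {}e1 := e1 (lexx _).
  have e2 := expectation_mod2_charfun_bridge_itv hT (ltW h0) (lexx T).
  have {}e2 := e2 l _ l0; rewrite (_ : T - T / 2 = T / 2) in e2; last by field.
  have {}e2 := e2 (lexx _).
  have le12 : \int[P]_w (D w ^+ 2) <=
      2^-1 * (\int[P]_w (D1 w ^+ 2) + \int[P]_w (D2 w ^+ 2)).
    have i12 := integrableD measurableT (iD 0 (T / 2) h0) (iD (T / 2) T hT).
    rewrite -RintegralD//; [|exact: (iD 0 (T / 2) h0)|exact: (iD (T / 2) T hT)].
    rewrite -RintegralZl//.
    apply: le_Rintegral => //; [exact: (iD 0 T T0)|exact: (integrableZl _ _ i12)|].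
    move=> w _.
    have D10 : 0 <= D1 w := mod2_charfun_ge0 _ _.
    have D20 : 0 <= D2 w := mod2_charfun_ge0 _ _.
    have D0 : 0 <= D w := mod2_charfun_ge0 _ _.
    have hD : D w <= (D1 w + D2 w) / 2.
      have mc := measurable_cos_comp (mZw w).
      have ms := measurable_sin_comp (mZw w).
      rewrite /D /D1 /D2 /mod2_charfun.
      rewrite (Rintegral_uniform_halves T0 h0 hT mc (fun t => norm_cos_le1 _)).
      rewrite (Rintegral_uniform_halves T0 h0 hT ms (fun t => norm_sin_le1 _)).
      move: (\int[_]_t cos _) (\int[_]_t cos _) (\int[_]_t sin _) (\int[_]_t sin _).
      move=> x1 x2 y1 y2; exact: sqr_half_le.
    apply: (@le_trans _ _ (((D1 w + D2 w) / 2) ^+ 2)).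
      by rewrite !expr2; exact: (ler_pM D0 D0 hD hD).
    exact: half_sqr_le.
  have kE : 3 * (2 * pi / (l ^+ 2 / 4 * (T / 2))) ^+ 2 = A / (l ^+ 2) ^+ 2.
    by rewrite /A; field; rewrite l0 gt_eqF.
  rewrite kE in e1 e2.
  have l4 : 0 < (l ^+ 2) ^+ 2 by rewrite lt0r sqrf_eq0 l20 sqr_ge0.
  rewrite -(ler_pdivlMr _ _ l4).
  have e1' : \int[P]_w (D1 w ^+ 2) <= A / (l ^+ 2) ^+ 2 := e1.
  have e2' : \int[P]_w (D2 w ^+ 2) <= A / (l ^+ 2) ^+ 2 := e2.
  exact: (le_trans le12 (half_add_le e1' e2')).
have D20 : 0 <= \int[P]_w (D w ^+ 2) by apply: Rintegral_ge0 => w _; exact: sqr_ge0.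
rewrite -/(D _); move: D20 EA E4; move: (\int[P]_w _) (A) (l ^+ 2) => x y z x0 xz x4.
have := mulr_ge0 x0 (sqr_ge0 (1 - z)); lra.
Qed.

End bridge_fourth_moment.

(** * Fourier representation of the approximate self-intersection local time *)

Section double_time_integral.
Context {R : realType}.
Local Notation mu := (@lebesgue_measure R).

(* [Q <=%R] and [Q <%R] split [f] along the diagonal, which is a null set. *)
Lemma Rintegral_triangle (T M : R) (T0 : 0 < T) (f : R * R -> R) :
  measurable_fun setT f -> (forall z, `|f z| <= M) ->
  (forall t s, f (t, s) = f (s, t)) ->
  \int[mu]_(t in `[0, T]) \int[mu]_(s in `[0, t]) f (t, s) =
  T ^+ 2 / 2 * \int[uniform_prob T0]_t \int[uniform_prob T0]_s f (t, s).
Proof.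
move=> mf fM fC; pose U := uniform_prob T0.
have M0 : 0 <= M := le_trans (normr_ge0 _) (fM (0, 0)).
have mft t : measurable_fun setT (fun s => f (t, s)) := measurable_fun_section t mf.
pose Q (lt : R -> R -> bool) (z : R * R) : R := if lt z.2 z.1 then f z else 0.
have QM lt z : `|Q lt z| <= M by rewrite /Q; case: ifP => // _; rewrite normr0.
have mle : measurable_fun setT (Q <=%R).
  apply: measurable_fun_ifT => //.
  by apply: measurable_fun_ler; [exact: measurable_snd|exact: measurable_fst].
have mlt : measurable_fun setT (Q <%R).
  apply: measurable_fun_ifT => //.
  by apply: measurable_fun_ltr; [exact: measurable_snd|exact: measurable_fst].
have Qle t : 0 <= t <= T ->
    \int[U]_s Q <=%R (t, s) = T^-1 * \int[mu]_(s in `[0, t]) f (t, s).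
  move=> /andP[t0 tT].
  rewrite (Rintegral_uniform T0 (measurable_fun_section t mle) (fun s => QM _ (t, s))).
  rewrite subr0; congr (_ * _).
  have -> : `[0, t]%classic = `[0, T] `&` `]-oo, t].
    apply/seteqP; split => s /=; rewrite !in_itv/=.
      by move=> /andP[-> st]; split; rewrite ?(le_trans st).
    by move=> [/andP[-> _] ->].
  rewrite Rintegral_mkcondr; apply: eq_Rintegral => s _.
  by rewrite /Q patchE /= mem_setE in_itv.
have Qlt t : 0 <= t <= T -> \int[U]_s Q <%R (t, s) = \int[U]_s Q <=%R (t, s).
  move=> tT; rewrite (Qle _ tT); move: tT => /andP[t0 tT].
  rewrite (Rintegral_uniform T0 (measurable_fun_section t mlt) (fun s => QM _ (t, s))).
  rewrite subr0; congr (_ * _).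
  rewrite -[RHS]Rintegral_itv_bndo_bndc; last first.
    apply: integrableS (@bounded_integrable_itv R 0 t M (fun s => f (t, s)) (mft t)
      (fun s => fM (t, s))) => //.
    by apply: subset_itvl; rewrite bnd_simp.
  have -> : `[0, t[%classic = `[0, T] `&` `]-oo, t[.
    apply/seteqP; split => s /=; rewrite !in_itv/=.
      by move=> /andP[-> st]; split; rewrite ?(le_trans (ltW st)).
    by move=> [/andP[-> _] ->].
  rewrite Rintegral_mkcondr; apply: eq_Rintegral => s _.
  by rewrite /Q patchE /= mem_setE in_itv.
have mEle := measurable_fun_Rintegral2 U mle.
have mElt := measurable_fun_Rintegral2 U mlt.
have EleM t : `|\int[U]_s Q <=%R (t, s)| <= M.
  have h := Rintegral_prob_bound U (measurable_fun_section t mle) (fun s => QM _ (t, s)).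
  exact: h.
have EltM t : `|\int[U]_s Q <%R (t, s)| <= M.
  have h := Rintegral_prob_bound U (measurable_fun_section t mlt) (fun s => QM _ (t, s)).
  exact: h.
have LHS : \int[mu]_(t in `[0, T]) \int[mu]_(s in `[0, t]) f (t, s) =
    T ^+ 2 * \int[U]_t \int[U]_s Q <=%R (t, s).
  rewrite (Rintegral_uniform T0 mEle EleM) subr0.
  have iE := bounded_integrable_itv 0 T mEle EleM.
  have -> : \int[mu]_(t in `[0, T]) \int[mu]_(s in `[0, t]) f (t, s) =
      \int[mu]_(t in `[0, T]) (T * \int[U]_s Q <=%R (t, s)).
    apply: eq_Rintegral => t; rewrite inE/= in_itv/= => /Qle ->.
    by rewrite mulrA divff ?mul1r// gt_eqF.
  rewrite RintegralZl; [|exact: measurable_itv|exact: iE].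
  rewrite expr2 -mulrA; congr (_ * _).
  by rewrite mulrA divff ?mul1r// gt_eqF.
pose Q' (z : R * R) := Q <%R (z.2, z.1).
have mQ' : measurable_fun setT Q'.
  by apply: (measurableT_comp mlt); exact: measurable_fun_pair.
(* Exchanging the two times turns the upper triangle into the open lower one, whose average equals
   that of the closed one. The square is thus twice the triangle. *)
have swap : \int[U]_t \int[U]_s Q' (t, s) = \int[U]_t \int[U]_s Q <=%R (t, s).
  have iM : U.-integrable setT (EFin \o cst M).
    exact: (@bounded_integrable _ _ _ U (cst M) `|M|).
  have Q'M t s : `|Q' (t, s)| <= M by exact: QM.
  have h := @dominated_fubini _ _ _ _ _ U U Q' (cst M).
  have {}h := h mQ'. have {}h := h iM. have {}h := h Q'M.
  rewrite h.
  exact: (eq_Rintegral_uniform T0 mElt EltM mEle EleM Qlt).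
have fE t s : f (t, s) = Q <=%R (t, s) + Q' (t, s).
  by rewrite /Q' /Q /=; case: (leP s t) => st; rewrite ?addr0 ?add0r//.
rewrite LHS -mulrA; congr (_ * _).
have -> : \int[U]_t \int[U]_s f (t, s) = \int[U]_t \int[U]_s Q <=%R (t, s) +
    \int[U]_t \int[U]_s Q' (t, s).
  have iA := bounded_integrable U mEle EleM.
  have EQ'M t : `|\int[U]_s Q' (t, s)| <= M.
    have h := Rintegral_prob_bound U (measurable_fun_section t mQ') (fun s => QM _ (s, t)).
    exact: h.
  have iB := bounded_integrable U (measurable_fun_Rintegral2 U mQ') EQ'M.
  rewrite -RintegralD; [|exact: measurableT|exact: iA|exact: iB].
  apply: eq_Rintegral => t _.
  have i1 := bounded_integrable U (measurable_fun_section t mle) (fun s => QM _ (t, s)).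
  have i2 := bounded_integrable U (measurable_fun_section t mQ') (fun s => QM _ (s, t)).
  rewrite -RintegralD; [|exact: measurableT|exact: i1|exact: i2].
  by apply: eq_Rintegral => s _; exact: fE.
by rewrite swap; field.
Qed.

(** The Gaussian dominates the integrand for all times, so the two time averages move inside the
    frequency integral one after the other; there [mod2_charfunE] recognises the squared modulus. *)
Lemma average_cos_gaussian (e T : R) (T0 : 0 < T) (Y : R -> R) : 0 < e ->
  measurable_fun setT Y ->
  \int[uniform_prob T0]_t \int[uniform_prob T0]_s
    \int[mu]_l (cos ((Y t - Y s) * l) * gaussian e l) =
  \int[mu]_l (gaussian e l * mod2_charfun (uniform_prob T0) (fun t => l * Y t)).
Proof.
move=> e0 mY; pose U := uniform_prob T0.
have ig := integrable_gaussian e0; have mg := @measurable_gaussian R e.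
have mgs (d : measure_display) (S : measurableType d) (h : S -> R) :
    measurable_fun setT h -> measurable_fun setT (fun z => gaussian e (h z)).
  exact: (measurableT_comp mg).
have mYs (d : measure_display) (S : measurableType d) (h : S -> R) :
    measurable_fun setT h -> measurable_fun setT (fun z => Y (h z)).
  exact: (measurableT_comp mY).
have m1 : measurable_fun setT (fun z : (R * R) * R => cos ((Y z.1.1 - Y z.2) * z.1.2)).
  apply: measurable_cos_comp; apply: measurable_funM.
    apply: measurable_funB; apply: mYs => //.
    by apply: (measurableT_comp measurable_fst); exact: measurable_fst.
  by apply: (measurableT_comp measurable_snd); exact: measurable_fst.
have mE := measurable_fun_Rintegral2 U m1.
have inner t : \int[U]_s \int[mu]_l (cos ((Y t - Y s) * l) * gaussian e l) =
    \int[mu]_l ((\int[U]_s cos ((Y t - Y s) * l)) * gaussian e l).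
  rewrite (@dominated_fubini _ _ _ _ _ U mu
    (fun z => cos ((Y t - Y z.1) * z.2) * gaussian e z.2) (gaussian e)) //.
  - apply: eq_Rintegral => l _ /=; rewrite RintegralZr//.
    apply: (@bounded_integrable _ _ _ U _ 1) => [|s]; last exact: norm_cos_le1.
    apply: measurable_cos_comp; apply: measurable_funM => //.
    exact: measurable_funB.
  - apply: measurable_funM; last exact: (mgs _ _ snd measurable_snd).
    apply: measurable_cos_comp; apply: measurable_funM => //.
    by apply: measurable_funB => //; exact: mYs.
  - move=> s l /=; rewrite normrM (ger0_norm (gaussian_ge0 _ _)).
    by rewrite ler_piMl ?gaussian_ge0// norm_cos_le1.
under eq_Rintegral do rewrite inner.
rewrite (@dominated_fubini _ _ _ _ _ U mu
  (fun z => (\int[U]_s cos ((Y z.1 - Y s) * z.2)) * gaussian e z.2) (gaussian e)) //.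
- apply: eq_Rintegral => l _ /=.
  rewrite RintegralZr//; last first.
    apply: (bounded_integrable U (M := 1)).
      apply: (measurableT_comp mE (g := fun t => (t, l))).
      exact: measurable_fun_pair.
    move=> t; apply: Rintegral_prob_bound => [|s]; last exact: norm_cos_le1.
    apply: measurable_cos_comp; apply: measurable_funM => //.
    exact: measurable_funB.
  rewrite mulrC; congr (_ * _); rewrite mod2_charfunE; last exact: measurable_funM.
  apply: eq_Rintegral => t _; apply: eq_Rintegral => s _.
  by rewrite -mulrBr mulrC.
- apply: measurable_funM; last exact: (mgs _ _ snd measurable_snd).
  exact: mE.
- move=> t l /=; rewrite normrM (ger0_norm (gaussian_ge0 _ _)).
  rewrite ler_piMl ?gaussian_ge0//.
  apply: Rintegral_prob_bound => [|s]; last exact: norm_cos_le1.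
  apply: measurable_cos_comp; apply: measurable_funM => //.
  exact: measurable_funB.
Qed.

End double_time_integral.

Lemma self_intersection_epsE {R : realType} {d : measure_display}
  {Om : measurableType d} (P : probability Om R) (B : R -> Om -> R)
  (T a b e : R) (T0 : 0 < T) (w : Om) : brownian_motion P B -> 0 < e ->
  self_intersection_eps B T a b e w = T ^+ 2 / (4 * pi) *
    \int[lebesgue_measure]_l (gaussian e l * mod2_charfun (uniform_prob T0)
      (fun t => l * brownian_bridge B T a b (clamp 0 T t) w)).
Proof.
move=> bmB e0; pose Y t := brownian_bridge B T a b (clamp 0 T t) w.
have mY : measurable_fun setT Y := measurable_bridge_path a b bmB T0 w.
pose c : R := (Num.sqrt (2 * pi * e))^-1.
have c0 : 0 <= c by rewrite invr_ge0 sqrtr_ge0.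
have pc x : `|heat_kernel e x| <= c.
  rewrite ger0_norm ?mulr_ge0 ?expR_ge0// /heat_kernel -/c ler_piMr//.
  rewrite -expR0 ler_expR mulNr oppr_le0 divr_ge0 ?sqr_ge0//.
  by rewrite mulr_ge0// ltW.
have mp : measurable_fun setT (@heat_kernel R e).
  apply: measurable_funM => //; apply: measurableT_comp => //.
  apply: measurable_funM => //; apply: measurableT_comp => //.
rewrite -average_cos_gaussian//.
have -> : \int[uniform_prob T0]_t \int[uniform_prob T0]_s
    \int[lebesgue_measure]_l (cos ((Y t - Y s) * l) * gaussian e l) =
  2 * pi * \int[uniform_prob T0]_t \int[uniform_prob T0]_s heat_kernel e (Y t - Y s).
  have kE t s : \int[lebesgue_measure]_l (cos ((Y t - Y s) * l) * gaussian e l) =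
      2 * pi * heat_kernel e (Y t - Y s).
    by rewrite heat_kernelE// mulrA mulfV ?mul1r// mulf_neq0// gt_eqF// pi_gt0.
  under eq_Rintegral do under eq_Rintegral do rewrite kE.
  have mf : measurable_fun setT (fun z : R * R => heat_kernel e (Y z.1 - Y z.2)).
    apply: (measurableT_comp mp); apply: measurable_funB.
      by apply: (measurableT_comp mY); exact: measurable_fst.
    by apply: (measurableT_comp mY); exact: measurable_snd.
  have i1 t := bounded_integrable (uniform_prob T0) (measurable_fun_section t mf)
    (fun s => pc _).
  have i2 := bounded_integrable (uniform_prob T0)
    (measurable_fun_Rintegral2 (uniform_prob T0) mf)
    (fun t => Rintegral_prob_bound (uniform_prob T0) (measurable_fun_section t mf)
      (fun s => pc _)).
  rewrite -RintegralZl//; apply: eq_Rintegral => t _.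
  by rewrite RintegralZl//; exact: i1.
have mf : measurable_fun setT (fun z : R * R => heat_kernel e (Y z.1 - Y z.2)).
  apply: (measurableT_comp mp); apply: measurable_funB.
    by apply: (measurableT_comp mY); exact: measurable_fst.
  by apply: (measurableT_comp mY); exact: measurable_snd.
(* The constant T^2 / (4 pi) is T^2 / 2, from the triangle, times 1 / (2 pi), from Fourier
   inversion. *)
transitivity (T ^+ 2 / 2 * \int[uniform_prob T0]_t
    \int[uniform_prob T0]_s heat_kernel e (Y t - Y s)); last first.
  rewrite [RHS]mulrA; congr (_ * _); have := pi_gt0 R; move: (pi : R) => p p0.
  by field; rewrite gt_eqF.
have fC t s : heat_kernel e (Y t - Y s) = heat_kernel e (Y s - Y t).
  by rewrite /heat_kernel -(sqrrN (Y t - Y s)) opprB.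
have tri := Rintegral_triangle T0 mf (fun z => pc _) fC.
transitivity (\int[lebesgue_measure]_(t in `[0, T])
  \int[lebesgue_measure]_(s in `[0, t]) heat_kernel e (Y t - Y s)); last exact: tri.
apply: eq_Rintegral => t; rewrite inE/= in_itv/= => /andP[t0 tT].
apply: eq_Rintegral => s; rewrite inE/= in_itv/= => /andP[s0 st].
by rewrite /Y !clamp_id// ?t0 ?s0//= (le_trans st).
Qed.

(** * Convergence *)

Lemma sqr_sub_le {R : realFieldType} (x y z : R) :
  x <= y -> y <= z -> (y - z) ^+ 2 <= (x - z) ^+ 2.
Proof.
rewrite -subr_ge0 -[y <= z]subr_ge0 => xy yz.
by have := mulr_ge0 xy xy; have := mulr_ge0 xy yz; lra.
Qed.

Section gaussian_mixture_limit.
Context {R : realType} {d : measure_display} {Om : measurableType d}.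
Local Notation mu := (@lebesgue_measure R).
Variables (P : probability Om R) (D : Om * R -> R) (C K : R).
Hypotheses (mD : measurable_fun setT D) (D0 : forall z, 0 <= D z)
  (D2 : forall z, D z <= 2) (K0 : 0 <= K)
  (DC : forall l, \int[P]_w (D (w, l) ^+ 2) <= C / (1 + l ^+ 2) ^+ 2).

(** The square root of the assumed decay of the second moment, integrable over the line. *)
Let q (l : R) : R := (1 + l ^+ 2)^-1.

Let q0 l : 0 < q l.
Proof. by rewrite invr_gt0; have := sqr_ge0 l; lra. Qed.

Let cq : continuous q.
Proof.
move=> l; apply: cvgV; first by rewrite gt_eqF//; have := sqr_ge0 l; lra.
by apply: cvgD; [exact: cvg_cst|exact: exprn_continuous].
Qed.

Let mq : measurable_fun setT (EFin \o q).
Proof. by apply/measurable_EFinP; apply: continuous_measurable_fun. Qed.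

Let integral_q : (\int[mu]_l (q l)%:E < +oo)%E.
Proof.
rewrite ge0_symfun_integralT//=.
- rewrite (_ : [set x | _] = `[0, +oo[%classic); last first.
    by apply/seteqP; split => x/=; rewrite in_itv/= andbT.
  by have -> := @integral0y_oneDsqr R; rewrite -EFinM ltry.
- by move=> l; exact: ltW.
- by move=> l; rewrite /q/= sqrrN.
Qed.

Let C0 : 0 <= C.
Proof.
have := DC 0; rewrite expr0n addr0 expr1n divr1; apply: le_trans.
by apply: Rintegral_ge0 => w _; exact: sqr_ge0.
Qed.

Let mDl l : measurable_fun setT (fun w => D (w, l)).
Proof. by apply: (measurableT_comp mD); exact: measurable_fun_pair. Qed.

Let mDw w : measurable_fun setT (fun l => D (w, l)).
Proof. exact: measurable_fun_section. Qed.

Let mDwE w : measurable_fun setT (fun l => (D (w, l))%:E).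
Proof.
have mDE : measurable_fun setT (EFin \o D) by exact/measurable_EFinP.
exact: (measurable_fun_section w mDE).
Qed.

Let normD z : `|D z| <= 2.
Proof. by rewrite ger0_norm. Qed.

(** Extended-real valued, because finiteness is only obtained almost surely, as a consequence of the
    second-moment bound. *)
Let H w : \bar R := (\int[mu]_l (D (w, l))%:E)%E.

Let H0 w : (0 <= H w)%E.
Proof. by apply: integral_ge0 => l _; rewrite lee_fin. Qed.

Let mH : measurable_fun setT H.
Proof.
apply: (@measurable_fun_fubini_tonelli_F _ _ _ _ _ mu (EFin \o D)).
  exact/measurable_EFinP.
by move=> z; rewrite lee_fin.
Qed.

(* AM-GM with weights [q m / q l] and [q l / q m]. *)
Let expectation_mul_le l m : \int[P]_w (D (w, l) * D (w, m)) <= C * q l * q m.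
Proof.
have iS l' : P.-integrable setT (EFin \o (fun w => D (w, l') ^+ 2)).
  apply: (@bounded_integrable _ _ _ P _ 4); first exact: measurable_funX.
  move=> w; rewrite normrX [leRHS](_ : _ = 2 ^+ 2); last by ring.
  by rewrite lerXn2r ?nnegrE.
have iM : P.-integrable setT (EFin \o (fun w => D (w, l) * D (w, m))).
  apply: (@bounded_integrable _ _ _ P _ 4); first exact: measurable_funM.
  by move=> w; rewrite normrM [leRHS](_ : _ = 2 * 2) ?ler_pM//; ring.
have i1 := integrableZl measurableT (q m / q l / 2) (iS l).
have i2 := integrableZl measurableT (q l / q m / 2) (iS m).
apply: (@le_trans _ _ (\int[P]_w (q m / q l / 2 * D (w, l) ^+ 2 +
    q l / q m / 2 * D (w, m) ^+ 2))).
  apply: le_Rintegral => //; first exact: (integrableD _ i1 i2).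
  move=> w _; move: (D (w, l)) (D (w, m)) (q0 l) (q0 m) => x y.
  move: (q l) (q m) => r s r0 s0.
  rewrite -subr_ge0 (_ : _ - _ = (s * x - r * y) ^+ 2 / (2 * r * s)).
    by rewrite divr_ge0 ?sqr_ge0// ltW// !mulr_gt0.
  by field; rewrite !gt_eqF.
rewrite RintegralD// !RintegralZl//.
have := DC l; have := DC m; rewrite -!exprVn -/(q l) -/(q m).
move: (\int[P]_w _) (\int[P]_w _) (q0 l) (q0 m) => y x.
move: (q l) (q m) => r s r0 s0 ys xr.
rewrite (_ : C * r * s = s / r / 2 * (C * r ^+ 2) + r / s / 2 * (C * s ^+ 2)).
  by rewrite lerD// ler_wpM2l// !divr_ge0// ltW.
by field; rewrite !gt_eqF.
Qed.

(** Writing H^2 as a double frequency integral and applying Tonelli twice leaves E[D(l) D(m)],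
    bounded by C q(l) q(m); the total is at most C times the square of the integral of [q]. *)
Let expectation_H_sqr : (\int[P]_w (H w * H w) < +oo)%E.
Proof.
have mDE : measurable_fun setT (EFin \o D) by exact/measurable_EFinP.
have D0E z : (0 <= (D z)%:E)%E by rewrite lee_fin.
have HD w l : ((D (w, l))%:E * H w = \int[mu]_m (D (w, l) * D (w, m))%:E)%E.
  rewrite /H -ge0_integralZl//; exact: mDwE.
have mF : measurable_fun setT (fun z : Om * R => ((D z)%:E * H z.1)%E).
  apply: emeasurable_funM => //.
  by apply: (measurableT_comp mH); exact: measurable_fst.
have -> : (\int[P]_w (H w * H w) = \int[P]_w \int[mu]_l ((D (w, l))%:E * H w))%E.
  apply: eq_integral => w _; rewrite ge0_integralZr//; exact: mDwE.
rewrite (@fubini_tonelli _ _ _ _ _ P mu (fun z => ((D z)%:E * H z.1)%E))//=; last first.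
  by move=> z; rewrite mule_ge0// lee_fin.
have inner l : (\int[P]_w ((D (w, l))%:E * H w) <= (C * q l)%:E * \int[mu]_m (q m)%:E)%E.
  under eq_integral do rewrite HD.
  have mG : measurable_fun setT (fun z : Om * R => (D (z.1, l) * D z)%:E).
    apply/measurable_EFinP; apply: measurable_funM => //.
    by apply: (measurableT_comp (mDl l)); exact: measurable_fst.
  rewrite (@fubini_tonelli _ _ _ _ _ P mu (fun z => (D (z.1, l) * D z)%:E))//=; last first.
    by move=> z; rewrite lee_fin mulr_ge0.
  rewrite -ge0_integralZl//; last 2 first.
  - by move=> m _; rewrite lee_fin ltW.
  - by rewrite lee_fin mulr_ge0// ltW.
  apply: ge0_le_integral => //.
  - by move=> m _; apply: integral_ge0 => w _; rewrite lee_fin mulr_ge0.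
  - apply: (@measurable_fun_fubini_tonelli_G _ _ _ _ _ P
      (fun z => (D (z.1, l) * D z)%:E)) => // z.
    by rewrite lee_fin mulr_ge0.
  - exact: (measurable_funeM _ mq).
  - move=> m _; rewrite -EFin_Rintegral//; last first.
      apply: (@bounded_integrable _ _ _ P _ 4); first exact: measurable_funM.
      by move=> w; rewrite normrM [leRHS](_ : _ = 2 * 2) ?ler_pM//; ring.
    by rewrite -EFinM lee_fin expectation_mul_le.
have kf : (\int[mu]_m (q m)%:E)%E \is a fin_num.
  by rewrite ge0_fin_numE// integral_ge0// => l _; rewrite lee_fin ltW.
apply: (@le_lt_trans _ _ (\int[mu]_l ((C * fine (\int[mu]_m (q m)%:E))%:E * (q l)%:E))%E).
  apply: ge0_le_integral => //.
  - by move=> l _; apply: integral_ge0 => w _; rewrite mule_ge0// lee_fin.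
  - apply: (@measurable_fun_fubini_tonelli_G _ _ _ _ _ P
      (fun z => ((D z)%:E * H z.1)%E)) => // z.
    by rewrite mule_ge0// lee_fin.
  - exact: (measurable_funeM _ mq).
  - move=> l _; apply: (le_trans (inner l)).
    by rewrite -(fineK kf) -!EFinM lee_fin/= mulrAC.
rewrite ge0_integralZl//; last 2 first.
- by move=> l _; rewrite lee_fin ltW.
- rewrite lee_fin mulr_ge0// fine_ge0// integral_ge0// => l _.
  by rewrite lee_fin ltW.
by rewrite -(fineK kf) -EFinM ltry.
Qed.

(** Where [H w] is infinite, [fine] makes this 0. That happens on a null set only, but comparisons
    of [J] with [I] must assume that [H w] is finite. *)
Let I w : R := K * fine (H w).
Let J e w : R := K * \int[mu]_l (gaussian e l * D (w, l)).

Let integrable_J e w : 0 < e ->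
  mu.-integrable setT (EFin \o (fun l => gaussian e l * D (w, l))).
Proof.
move=> e0; have := @integrable_mul_gaussian R e (fun l => D (w, l)) 2 e0 (mDw w).
move=> h; rewrite (_ : EFin \o _ = fun l => (D (w, l) * gaussian e l)%:E).
  apply: h => l; apply: (le_trans (normD _)).
  by rewrite -[leLHS]mulr1 ler_wpM2l// lerDl.
by apply/funext => l /=; rewrite mulrC.
Qed.

Let J_ge0 e w : 0 <= J e w.
Proof.
rewrite mulr_ge0// Rintegral_ge0// => l _.
by rewrite mulr_ge0// gaussian_ge0.
Qed.

Let J_anti e e' w : 0 < e -> e <= e' -> J e' w <= J e w.
Proof.
move=> e0 ee'; rewrite ler_wpM2l//; apply: le_Rintegral => //.
- exact: (integrable_J w (lt_le_trans e0 ee')).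
- exact: (integrable_J w e0).
move=> l _; rewrite ler_wpM2r// ler_expR lerN2 ler_wpM2r//.
by rewrite ler_wpM2r ?sqr_ge0.
Qed.

Let integrable_D w : H w \is a fin_num ->
  mu.-integrable setT (EFin \o (fun l => D (w, l))).
Proof.
move=> Hw; apply/integrableP; split; first exact: mDwE.
under eq_integral do rewrite /= ger0_norm//.
by rewrite -/(H w) -ge0_fin_numE.
Qed.

Let J_le_I e w : 0 < e -> H w \is a fin_num -> J e w <= I w.
Proof.
move=> e0 Hw; rewrite ler_wpM2l//.
apply: le_Rintegral => //; [exact: integrable_J|exact: integrable_D|].
move=> l _; rewrite ler_piMl// -expR0 ler_expR oppr_le0 divr_ge0//.
by rewrite mulr_ge0 ?sqr_ge0// ltW.
Qed.

(** For a path with finite [H w], the function D(w, .) is itself integrable and dominates all the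
    damped integrands. *)
Let J_cvg_I w : H w \is a fin_num -> J (harmonic n) w @[n --> \oo] --> I w.
Proof.
move=> Hw; apply: cvgM; first exact: cvg_cst.
have iD := integrable_D Hw.
have hm n : measurable_fun setT (fun l => (gaussian (harmonic n) l * D (w, l))%:E).
  by have /integrableP[] := integrable_J w (harmonic_gt0 n : (0 : R) < harmonic n).
have hc l : [set: R] l ->
    (gaussian (harmonic n) l * D (w, l))%:E @[n --> \oo] --> (D (w, l))%:E.
  move=> _; apply: cvg_EFin; first exact: nearW.
  rewrite -[X in _ --> X]mul1r; apply: cvgM; last exact: cvg_cst.
  have -> : (1 : R) = expR (- (0 * l ^+ 2 / 2)) by rewrite !mul0r oppr0 expR0.
  apply: (cvg_comp (fun n => - (harmonic n * l ^+ 2 / 2)) expR); last exact: continuous_expR.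
  apply: cvgN; do 2 (apply: cvgM; last exact: cvg_cst).
  exact: cvg_harmonic.
have hb n l : [set: R] l ->
    (`|(gaussian (harmonic n) l * D (w, l))%:E| <= (D (w, l))%:E)%E.
  move=> _; rewrite gee0_abs ?lee_fin ?mulr_ge0 ?gaussian_ge0//.
  rewrite ler_piMl// -expR0 ler_expR oppr_le0 divr_ge0//.
  by rewrite mulr_ge0 ?sqr_ge0 ?harmonic_ge0.
apply: fine_cvg; rewrite fineK//.
have h := @dominated_cvg _ _ _ mu setT measurableT
  (fun n l => (gaussian (harmonic n) l * D (w, l))%:E)
  (fun l => (D (w, l))%:E) (fun l => (D (w, l))%:E).
by apply: h => //; exact: hm.
Qed.

Let mI : measurable_fun setT I.
Proof.
apply: measurable_funM => //.
exact: (measurableT_comp (@fine_measurable R setT measurableT) mH).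
Qed.

Let mJ e : measurable_fun setT (J e).
Proof.
apply: measurable_funM => //.
apply: (@measurable_fun_Rintegral2 _ _ _ _ _ mu (fun z => gaussian e z.2 * D z)).
apply: measurable_funM => //.
by apply: (measurableT_comp (@measurable_gaussian R e)); exact: measurable_snd.
Qed.

Let I_sqr_integrable : (\int[P]_w ((I w) ^+ 2)%:E < +oo)%E.
Proof.
apply: (@le_lt_trans _ _ (\int[P]_w ((K ^+ 2)%:E * (H w * H w)))%E).
  apply: ge0_le_integral => //.
  - by move=> w _; rewrite lee_fin sqr_ge0.
  - by apply/measurable_EFinP; exact: measurable_funX.
  - by apply: measurable_funeM; exact: emeasurable_funM.
  - move=> w _; have [Hw|Hw] := boolP (H w \is a fin_num).
      by rewrite -(fineK Hw) -!EFinM lee_fin /I exprMn !expr2.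
    rewrite /I (_ : fine (H w) = 0) ?mulr0 ?expr0n/=.
      by rewrite mule_ge0 ?lee_fin ?sqr_ge0// mule_ge0.
    by move: Hw; case: (H w).
rewrite ge0_integralZl//; last 3 first.
- exact: emeasurable_funM.
- by move=> w _; exact: mule_ge0.
- by rewrite lee_fin sqr_ge0.
by rewrite lte_mul_pinfty// lee_fin sqr_ge0.
Qed.

(** An integrable function is almost surely finite, and an infinite [H w] would have an infinite
    square. *)
Let ae_fin : {ae P, forall w, H w \is a fin_num}.
Proof.
have : P.-integrable setT (fun w => (H w * H w)%E).
  apply/integrableP; split; first exact: emeasurable_funM.
  by under eq_integral do rewrite gee0_abs ?mule_ge0//.
move/(integrable_ae measurableT); apply: filterS => w /(_ Logic.I).
by case: (H w) (H0 w) => //; rewrite mulyy.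
Qed.

Lemma gaussian_mixture_L2_cvg : exists I : Om -> R,
  [/\ measurable_fun setT I,
      (\int[P]_w ((I w) ^+ 2)%:E < +oo)%E
    & (fun e : R => (\int[P]_w ((K * \int[mu]_l (gaussian e l * D (w, l)) -
          I w) ^+ 2)%:E)%E) @ 0^'+ --> 0%E].
Proof.
exists I; split; [exact: mI|exact: I_sqr_integrable|].
pose F e := (\int[P]_w ((J e w - I w) ^+ 2)%:E)%E; rewrite -/F.
have mF e : measurable_fun setT (fun w => ((J e w - I w) ^+ 2)%:E).
  by apply/measurable_EFinP; apply: measurable_funX; exact: measurable_funB.
have F0 e : (0 <= F e)%E by apply: integral_ge0 => w _; rewrite lee_fin sqr_ge0.
have iI : P.-integrable setT (fun w => ((I w) ^+ 2)%:E).
  apply/integrableP; split.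
    by apply/measurable_EFinP; exact: measurable_funX.
  under eq_integral do rewrite gee0_abs ?lee_fin ?sqr_ge0//.
  exact: I_sqr_integrable.
(* Dominated convergence is applied along the sequence e = 1/(n+1), with I^2 as dominating function
   since 0 <= J <= I almost surely. *)
have lim : F (harmonic n) @[n --> \oo] --> 0%E.
  have [] := @dominated_convergence _ _ _ P setT measurableT
    (fun n w => ((J (harmonic n) w - I w) ^+ 2)%:E) (cst 0%E)
    (fun w => ((I w) ^+ 2)%:E).
  - by move=> n; exact: mF.
  - exact: measurable_cst.
  - apply: filterS ae_fin => w Hw _; apply: cvg_EFin; first exact: nearW.
    have h : J (harmonic n) w - I w @[n --> \oo] --> (0 : R).
      rewrite -[X in _ --> X](subrr (I w)); apply: cvgB; last exact: cvg_cst.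
      exact: J_cvg_I.
    rewrite -[X in _ --> X](mulr0 (0 : R)).
    under eq_fun do rewrite expr2.
    exact: cvgM.
  - exact: iI.
  - apply: filterS ae_fin => w Hw n _; rewrite gee0_abs ?lee_fin ?sqr_ge0//.
    have h1 := J_le_I (harmonic_gt0 n) Hw; have h0 := J_ge0 (harmonic n) w.
    rewrite -sqrrN opprB; apply: lerXn2r; rewrite ?nnegrE ?subr_ge0 ?gerBl//.
    exact: le_trans h0 h1.
  by move=> _ _; rewrite integral_cst// mul0e.
(* From J e' <= J e <= I the error decreases with [e]; this carries the limit along the sequence
   over to the full limit from the right. *)
have anti e e' : 0 < e -> e <= e' -> (F e <= F e')%E.
  move=> e0 ee'.
  have sq0 e1 w : [set: Om] w -> (0 <= ((J e1 w - I w) ^+ 2)%:E)%E.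
    by rewrite lee_fin sqr_ge0.
  apply: (ae_ge0_le_integral measurableT (sq0 e) (mF e) (sq0 e') (mF e')).
  apply: filterS ae_fin => w Hw _; rewrite lee_fin.
  have h1 := J_le_I e0 Hw; have h2 := J_anti w e0 ee'.
  exact: (sqr_sub_le h2 h1).
have lim_near (x : R) : 0 < x -> \forall e \near 0^'+, (F e < x%:E)%E.
  move=> x0; have /fine_cvgP[finN /cvgrPdist_lt/(_ _ x0) ltN] := lim.
  have [N _ FN] : \forall n \near \oo, (F (harmonic n) < x%:E)%E.
    near=> n; have fn : F (harmonic n) \is a fin_num by near: n.
    have Fn : `|0 - fine (F (harmonic n))| < x by near: n; exact: ltN.
    rewrite -(fineK fn) lte_fin; apply: le_lt_trans Fn.
    by rewrite sub0r normrN ler_norm.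
  near=> e; apply: le_lt_trans (FN N (leqnn N)); apply: anti => //.
  near: e; apply: nbhs_right_le; exact: harmonic_gt0.
apply/fine_cvgP; split.
  near=> e; rewrite ge0_fin_numE//; apply: (@lt_trans _ _ (1 : R)%:E); last exact: ltry.
  by near: e; exact: lim_near.
apply/cvgrPdist_lt => x x0; near=> e.
have Fx : (F e < x%:E)%E by near: e; exact: lim_near.
rewrite /= sub0r normrN ger0_norm ?fine_ge0//.
by rewrite -lte_fin fineK// ge0_fin_numE// (lt_trans Fx)// ltry.
Unshelve. all: end_near. Qed.

End gaussian_mixture_limit.

Theorem theorem3p1 (R : realType) (d : measure_display) (Om : measurableType d)
  (P : probability Om R) (B : R -> Om -> R) (T a b : R) :
  brownian_motion P B -> 0 < T ->
  exists I : Om -> R,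
    [/\ measurable_fun setT I,
        (\int[P]_w ((I w) ^+ 2)%:E < +oo)%E
      & (fun eps : R =>
           (\int[P]_w ((self_intersection_eps B T a b eps w - I w) ^+ 2)%:E)%E)
          @ 0^'+ --> 0%E].
Proof.
move=> bmB T0.
pose D (z : Om * R) := mod2_charfun (uniform_prob T0)
  (fun t => z.2 * brownian_bridge B T a b (clamp 0 T t) z.1).
have mD : measurable_fun setT D.
  apply: (measurable_mod2_charfun (uniform_prob T0) (Z := fun u : (Om * R) * R =>
    u.1.2 * brownian_bridge B T a b (clamp 0 T u.2) u.1.1)).
  apply: measurable_funM.
    by apply: (measurableT_comp measurable_snd); exact: measurable_fst.
  apply: (measurableT_comp (measurable_bridge a b bmB T0)
    (g := fun u : (Om * R) * R => (u.1.1, u.2))).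
  apply: measurable_fun_pair => //.
  by apply: (measurableT_comp measurable_fst); exact: measurable_fst.
have D0 z : 0 <= D z by exact: mod2_charfun_ge0.
have D2 z : D z <= 2.
  apply: mod2_charfun_le2; apply: measurable_funM => //.
  exact: (measurable_bridge_path a b bmB T0).
have [C DC] := expectation_mod2_charfun_bridge_le a b bmB T0.
have K0 : 0 <= T ^+ 2 / (4 * pi).
  by rewrite divr_ge0 ?sqr_ge0// mulr_ge0// pi_ge0.
have [I [mI I2 cvgI]] := gaussian_mixture_L2_cvg mD D0 D2 K0 DC.
(* The Fourier representation holds for e > 0, so the two functions of [e] agree near 0 from the
   right, which is enough for the limit. *)
exists I; split => //; apply: cvg_trans cvgI; apply: near_eq_cvg.
near=> e; apply: eq_integral => w _.
by rewrite (self_intersection_epsE _ _ T0 w bmB).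
Unshelve. all: end_near. Qed.
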